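(* (Submultiplicativity of burden.) Work in a monster model of a positive theory with the Joint Continuation Property. Let $E$ be a set of parameters and $a_0,\dots,a_{n-1}$ tuples. If $\operatorname{bdn}(a_i/E)<k_i$ for $i<n$ with $k_i<\omega$, then $\operatorname{bdn}(a_0,\dots,a_{n-1}/E)<\prod_{i<n}k_i$.
   Context: Positive logic: positive formulas are those built from atomic formulas with $\wedge,\vee,\exists$; a positive (h-inductive) theory $T$ is a set of sentences $\forall x(\phi\to\psi)$ with $\phi,\psi$ positive. A model of $T$ is positively existentially closed (pec) if every homomorphism from it to a model of $T$ reflects positive formulas. $T$ has the Joint Continuation Property if any two models admit homomorphisms to a common model. A monster model is a sufficiently saturated (for positive formulas) and strongly homogeneous pec model. ''Formula'' means positive formula; ''type'' means (partial) positive type; parameter sets are small. $T$ is not assumed thick. Let $\pi(x)$ be a partial type and $\kappa$ a (possibly finite) cardinal. An $\mathrm{inp}$-pattern in $\pi(x)$ of depth $\kappa$ consists of an array $(a_{\alpha,i})_{\alpha<\kappa,i<\omega}$ and, for each $\alpha<\kappa$, a formula $\phi_\alpha(x,y_\alpha)$, such that: (1) for every $\alpha<\kappa$ there are $k_\alpha<\omega$ and a formula $\psi_\alpha(y_{\alpha,0},\dots,y_{\alpha,k_\alpha-1})$ such that $\models\neg\exists x,y_{\alpha,0},\dots,y_{\alpha,k_\alpha-1}\,(\psi_\alpha(y_{\alpha,0},\dots,y_{\alpha,k_\alpha-1})\wedge\bigwedge_{i<k_\alpha}\phi_\alpha(x,y_{\alpha,i}))$ and $\models\psi_\alpha(a_{\alpha,i_0},\dots,a_{\alpha,i_{k_\alpha-1}})$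 for all $i_0<\dots<i_{k_\alpha-1}<\omega$; and (2) for every $f\colon\kappa\to\omega$ the set $\pi(x)\cup\{\phi_\alpha(x,a_{\alpha,f(\alpha)})\mid\alpha<\kappa\}$ is consistent. The burden $\operatorname{bdn}(\pi)$ is the supremum of the depths of all $\mathrm{inp}$-patterns in $\pi(x)$ if it exists, and $\infty$ otherwise. $\operatorname{bdn}(a/E)$ means $\operatorname{bdn}(\operatorname{tp}(a/E))$. *)

(* Defs.v *)
From mathcomp Require Import all_boot.
From mathcomp Require Import boolp classical_sets functions cardinality.

Set Implicit Arguments.
Unset Strict Implicit.
Unset Printing Implicit Defensive.

Local Open Scope classical_set_scope.
Local Open Scope card_scope.

Record signature := Signature {
  fsym : Type;
  farity : fsym -> nat;
  rsym : Type;
  rarity : rsym -> nat }.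

(* Terms and positive formulas are well scoped: V is the type of free
   variables, possibly infinite, and pEx binds the variable None. *)
Inductive term (L : signature) (V : Type) : Type :=
| tVar of V
| tApp (f : fsym L) of 'I_(farity f) -> term L V.
Arguments tVar {L V} _.
Arguments tApp {L V} f _.

(* Truth and falsity count as atomic formulas. *)
Inductive pformula (L : signature) (V : Type) : Type :=
| pTop
| pBot
| pEq of term L V & term L V
| pRel (r : rsym L) of 'I_(rarity r) -> term L V
| pAnd of pformula L V & pformula L V
| pOr of pformula L V & pformula L V
| pEx of pformula L (option V).
Arguments pTop {L V}.
Arguments pBot {L V}.
Arguments pRel {L V} r _.

Record structure (L : signature) := Structure {
  carrier :> Type;
  carrier_inhabited : inhabited carrier;
  fint : forall f : fsym L, ('I_(farity f) -> carrier) -> carrier;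
  rint : forall r : rsym L, ('I_(rarity r) -> carrier) -> Prop }.

Fixpoint eval L (M : structure L) (V : Type) (v : V -> M) (t : term L V) : M :=
  match t with
  | tVar x => v x
  | tApp f ts => fint (fun i => eval v (ts i))
  end.

Fixpoint sat L (M : structure L) (V : Type) (phi : pformula L V) (v : V -> M) :
    Prop :=
  match phi with
  | pTop => True
  | pBot => False
  | pEq s t => eval v s = eval v t
  | pRel r ts => rint (fun i => eval v (ts i))
  | pAnd p q => sat p v /\ sat q v
  | pOr p q => sat p v \/ sat q v
  | pEx p => exists m : M, sat p (oapp v m)
  end.

Definition hom L (M N : structure L) (h : M -> N) : Prop :=
  (forall (f : fsym L) u, h (fint (f := f) u) = fint (f := f) (h \o u)) /\
  (forall (r : rsym L) u, rint (r := r) u -> rint (r := r) (h \o u)).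

Definition automorphism L (M : structure L) (s : M -> M) : Prop :=
  hom s /\ exists s', [/\ hom s', cancel s s' & cancel s' s].

(* The sentence  forall x_0 ... x_(n-1), hyp -> concl. *)
Record hsentence (L : signature) := HSentence {
  hvars : nat;
  hhyp : pformula L 'I_hvars;
  hconcl : pformula L 'I_hvars }.

Definition theory (L : signature) := set (hsentence L).

Definition model L (T : theory L) (M : structure L) : Prop :=
  forall s, T s -> forall v : 'I_(hvars s) -> M,
    sat (hhyp s) v -> sat (hconcl s) v.

Definition pec L (T : theory L) (M : structure L) : Prop :=
  model T M /\
  forall (N : structure L) (h : M -> N), model T N -> hom h ->
  forall (V : Type) (phi : pformula L V) (v : V -> M),
    sat phi (h \o v) -> sat phi v.

Definition joint_continuation L (T : theory L) : Prop :=
  forall M N : structure L, model T M -> model T N ->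
  exists (P : structure L) (f : M -> P) (g : N -> P),
    [/\ model T P, hom f & hom g].

Definition join (X Y Z : Type) (x : X -> Z) (y : Y -> Z) (s : X + Y) : Z :=
  match s with inl i => x i | inr j => y j end.

(* phi(x, c), for a positive formula phi without parameters in the variables
   x = (x_i)_(i : X) and a finite tuple c of parameters of M. *)
Record Mformula L (M : structure L) (X : Type) := MFormula {
  mlen : nat;
  mform : pformula L (X + 'I_mlen);
  mpar : 'I_mlen -> M }.
Arguments mpar {L M X} m _.

Definition over L (M : structure L) (X : Type) (A : set M)
    (Sigma : set (Mformula M X)) :=
  forall phi, Sigma phi -> forall j, A (mpar phi j).

Definition msat L (M : structure L) (X : Type) (x : X -> M) (phi : Mformula M X) :=
  sat (mform phi) (join x (mpar phi)).

Definition realizes L (M : structure L) (X : Type) (x : X -> M)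
    (Sigma : set (Mformula M X)) : Prop :=
  forall phi, Sigma phi -> msat x phi.

(* Realized in some model of T continuing M, the parameters being carried
   along; this makes sense without any bound on the size of Sigma. *)
Definition consistent L (T : theory L) (M : structure L) (X : Type)
    (Sigma : set (Mformula M X)) : Prop :=
  exists (N : structure L) (h : M -> N) (x : X -> N),
    [/\ model T N, hom h & forall phi, Sigma phi ->
        sat (mform phi) (join x (h \o mpar phi))].

(* tp(a/E) *)
Definition tp L (M : structure L) (X : Type) (a : X -> M) (E : set M) :
    set (Mformula M X) :=
  [set phi | (forall j, E (mpar phi j)) /\ msat a phi].

(* Cardinals are represented by types. *)
Definition card_lt (T U : Type) (A : set T) (B : set U) : Prop :=
  (A #<= B) /\ ~ (B #<= A).

Definition small (kappa T : Type) (A : set T) : Prop :=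
  card_lt A [set: kappa].

Definition saturated L (kappa : Type) (M : structure L) : Prop :=
  forall (X : Type) (A : set M) (Sigma : set (Mformula M X)),
    small kappa [set: X] -> small kappa A -> over A Sigma ->
    (forall F, finite_set F -> F `<=` Sigma -> exists x, realizes x F) ->
    exists x, realizes x Sigma.

Definition strongly_homogeneous L (kappa : Type) (M : structure L) : Prop :=
  forall (X : Type) (a b : X -> M), small kappa [set: X] ->
    (forall phi : pformula L X, sat phi a <-> sat phi b) ->
    exists2 s, automorphism s & s \o a = b.

(* "Sufficiently" saturated: kappa is uncountable and larger than the number
   of symbols, and "small" means of cardinality less than kappa. *)
Record monster L (T : theory L) (kappa : Type) (M : structure L) : Prop :=
  Monster {
    monster_uncountable : small kappa [set: nat];
    monster_fsym : small kappa [set: fsym L];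
    monster_rsym : small kappa [set: rsym L];
    monster_pec : pec T M;
    monster_saturated : saturated kappa M;
    monster_homogeneous : strongly_homogeneous kappa M }.

(* Depth is the cardinality of K. Since a formula has finitely many free
   variables, the tuples y_alpha are finite, of length inp_len alpha. *)
Record inp_pattern L (T : theory L) (M : structure L) (X : Type)
    (pi : set (Mformula M X)) (K : Type) := InpPattern {
  inp_len : K -> nat;
  inp_array : forall alpha, nat -> 'I_(inp_len alpha) -> M;
  inp_form : forall alpha, pformula L (X + 'I_(inp_len alpha));
  inp_inconsistent : forall alpha,
    exists (k : nat) (psi : pformula L ('I_k * 'I_(inp_len alpha))),
      (~ exists (x : X -> M) (y : 'I_k -> 'I_(inp_len alpha) -> M),
          sat psi (fun p => y p.1 p.2) /\
          forall i, sat (inp_form alpha) (join x (y i))) /\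
      (forall s : 'I_k -> nat, (forall i j : 'I_k, i < j -> s i < s j) ->
          sat psi (fun p => inp_array (s p.1) p.2));
  inp_consistent : forall f : K -> nat,
    consistent T (pi `|`
      [set MFormula (inp_form alpha) (inp_array (alpha := alpha) (f alpha))
        | alpha in [set: K]]) }.

Definition bounds_depths L (T : theory L) (M : structure L) (X : Type)
    (pi : set (Mformula M X)) (C : Type) : Prop :=
  forall K : Type, inhabited (inp_pattern T pi K) -> [set: K] #<= [set: C].

(* bdn(pi) is the cardinality of C; bdn(pi) is infinity if there is no such C. *)
Definition is_burden L (T : theory L) (M : structure L) (X : Type)
    (pi : set (Mformula M X)) (C : Type) : Prop :=
  bounds_depths T pi C /\
  forall C' : Type, bounds_depths T pi C' -> [set: C] #<= [set: C'].

Definition burden_lt L (T : theory L) (M : structure L) (X : Type)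
    (pi : set (Mformula M X)) (k : nat) : Prop :=
  exists2 C : Type, is_burden T pi C & card_lt [set: C] [set: 'I_k].

Definition concat n (X : 'I_n -> Type) (Z : Type) (a : forall i, X i -> Z)
    (p : {i : 'I_n & X i}) : Z :=
  a (projT1 p) (projT2 p).

(* Main.v *)
Require Import Defs.
From mathcomp Require Import all_boot.
From mathcomp Require Import boolp classical_sets functions cardinality filter.

Set Implicit Arguments.
Unset Strict Implicit.
Unset Printing Implicit Defensive.

Local Open Scope classical_set_scope.
Local Open Scope card_scope.

(** The burden of tp(a/E) is less than k exactly when this type has no
    inp-pattern of depth k (burden_ltP).  So an inp-pattern whose depth is the
    product of the k i in the type of the concatenated tuple has to produce one
    of depth k i in some tp(a i/E).  A pattern of finite depth mentions finitely
    many of the variables x (inp_restrict), and patterns pass from a subtuple to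
    the whole tuple (has_pattern_extend); hence the tuples may be taken finite,
    and by induction there are two of them, a and b (many_tuples, two_tuples).

    The rows of the given array are then indexed by pairs (al, be), al < k and
    be < l.  Suppose that tp(a/E) has no pattern of depth k.  In each column be
    one row is selected, and the array is changed, until a single x realizing
    tp(a/E) suits all choices f of an entry in the selected rows: for each f
    there is x' such that (x, x') realizes tp(ab/E) and satisfies the l
    formulas at the entries chosen by f.  With x among the parameters, the
    selected rows form a pattern of depth l in tp(b/E).

    The columns are treated one after the other.  The tool is replace_row:
    one of the k rows of the current column can be replaced by a row whose
    entries all share a solution x, without losing any type-definable property
    of the row that is inherited by subsequences.  If this failed for each of
    the k rows, compactness would give k formulas having finitely many
    instances contradicted by what is known of every increasing tuple of
    entries, which is a pattern of depth k in tp(a/E).  The replacement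
    serves one choice h of entries in the columns still to come.
    What was obtained for other choices is inherited by subsequences of the
    rows of the current column, so it survives later replacements, and
    compactness yields a single array for all h; but the row al selected
    depends on h (progress_all).  Colour h by al: a polarized pigeonhole
    principle gives arbitrarily large finite boxes of one colour (polarized),
    and compactness turns them into an array where one al serves all h
    (next_stage).

    Compactness inside M is saturation; it makes type-definable sets closed
    under projection (tdef_ex), so all conditions above are type-definable.
    Contradictions over parameters of M become contradictions between
    parameter-free positive formulas because M is positively existentially
    closed (neg_witness). *)

(** * Renaming, finite support and existential closure of positive formulas *)

Fixpoint trename L V W (s : V -> W) (t : term L V) : term L W :=
  match t with
  | tVar x => tVar (s x)
  | tApp f ts => tApp f (fun i => trename s (ts i))
  end.

Fixpoint frename L V W (s : V -> W) (phi : pformula L V) : pformula L W :=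
  match phi with
  | pTop => pTop
  | pBot => pBot
  | pEq t u => pEq (trename s t) (trename s u)
  | pRel r ts => pRel r (fun i => trename s (ts i))
  | pAnd p q => pAnd (frename s p) (frename s q)
  | pOr p q => pOr (frename s p) (frename s q)
  | pEx p => pEx (frename (omap s) p)
  end.

Lemma eval_trename L (N : structure L) V W (s : V -> W) (t : term L V) (w : W -> N) :
  eval w (trename s t) = eval (w \o s) t.
Proof.
by elim: t => //= f ts IH; congr (fint _); apply/funext => i; rewrite IH.
Qed.

Lemma sat_frename L (N : structure L) V W (s : V -> W) (phi : pformula L V)
  (w : W -> N) : sat (frename s phi) w = sat phi (w \o s).
Proof.
elim: phi W s w => //=.
- by move=> {}V t u W s w; rewrite !eval_trename.
- by move=> {}V r ts W s w; congr (rint _); apply/funext => i; rewrite eval_trename.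
- by move=> {}V p IHp q IHq W s w; rewrite IHp IHq.
- by move=> {}V p IHp q IHq W s w; rewrite IHp IHq.
- move=> {}V p IH W s w; congr (exists m, _); apply/funext => m.
  by rewrite IH; congr (sat p _); apply/funext => -[].
Qed.

Definition supported L V (phi : pformula L V) (s : seq {classic V}) :=
  forall (N : structure L) (v w : V -> N),
    (forall x : {classic V}, x \in s -> v x = w x) -> sat phi v -> sat phi w.

Lemma term_support L V (t : term L V) : exists s : seq {classic V},
  forall (N : structure L) (v w : V -> N),
    (forall x : {classic V}, x \in s -> v x = w x) -> eval v t = eval w t.
Proof.
elim: t => [x|f ts IH] /=.
  exists [:: x : {classic V}] => N v w vw; by apply: vw; rewrite inE.
have [S HS] := choice IH.
exists (flatten [seq S i | i <- enum 'I_(farity f)]) => N v w vw.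
congr (fint _); apply/funext => i; apply: HS => x xS; apply: vw.
by apply/flattenP; exists (S i) => //; apply/map_f; rewrite mem_enum.
Qed.

Lemma support_exists L V (phi : pformula L V) : exists s, supported phi s.
Proof.
elim: phi => {V}.
- by move=> V; exists [::] => N v w.
- by move=> V; exists [::] => N v w.
- move=> V t u; have [s Hs] := term_support t; have [s' Hs'] := term_support u.
  exists (s ++ s') => N v w vw /=.
  by rewrite (Hs _ v w) ?(Hs' _ v w) // => x xs; apply: vw; rewrite mem_cat xs ?orbT.
- move=> V r ts; have [S HS] := choice (fun i => term_support (ts i)).
  exists (flatten [seq S i | i <- enum 'I_(rarity r)]) => N v w vw /=.
  congr (rint _); apply/funext => i; apply: HS => x xS; apply: vw.
  by apply/flattenP; exists (S i) => //; apply/map_f; rewrite mem_enum.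
- move=> V p [s Hs] q [s' Hs']; exists (s ++ s') => N v w vw [satp satq].
  by split; [move: satp; apply: Hs|move: satq; apply: Hs'] => x xs; apply: vw;
    rewrite mem_cat xs ?orbT.
- move=> V p [s Hs] q [s' Hs']; exists (s ++ s') => N v w vw [satp|satq].
  + by left; move: satp; apply: Hs => x xs; apply: vw; rewrite mem_cat xs.
  + by right; move: satq; apply: Hs' => x xs; apply: vw; rewrite mem_cat xs orbT.
- move=> V p [s Hs]; exists (pmap (fun o : {classic option V} => o : option {classic V}) s).
  move=> N v w vw [m satm].
  exists m; move: satm; apply: Hs => -[x|] //= xs; apply: vw.
  by rewrite mem_pmap; apply/mapP; exists (Some x).
Qed.

(** The retraction r onto finitely many names turns a formula supported by s
    into an equivalent one in the variables 'I_n, with e to evaluate them. *)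
Lemma finite_names V (s : seq {classic V}) :
  exists n (r : V -> 'I_n) (e : 'I_n -> V), forall x, x \in s -> e (r x) = x.
Proof.
have [[v0]|no] := pselect (inhabited V); last first.
  have no' (x : V) : False by apply: no.
  have no0 : 'I_0 -> False by case.
  exists 0, (fun x => match no' x with end), (fun i => match no0 i with end).
  by move=> x; case: (no' x).
exists (size s).+1, (fun x => inord (index (x : {classic V}) s)),
  (fun j => nth (v0 : {classic V}) s j) => x xs.
by rewrite inordK ?nth_index // ltnS index_size.
Qed.

Lemma ex_closure_ord L V n (phi : pformula L (V + 'I_n)) : exists psi : pformula L V,
  forall (N : structure L) (v : V -> N),
    sat psi v <-> exists w : 'I_n -> N, sat phi (join v w).
Proof.
elim: n V phi => [|n IH] V phi.
  have no : 'I_0 -> False by case.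
  pose s (x : V + 'I_0) : V :=
    match x with inl x => x | inr i => match no i with end end.
  exists (frename s phi) => N v; rewrite sat_frename.
  have E (w : 'I_0 -> N) : join v w = v \o s by apply/funext => -[x|[]].
  split=> [h|[w]]; last by rewrite E.
  have w0 : 'I_0 -> N by case.
  by exists w0; rewrite E.
pose s (x : V + 'I_n.+1) : option (V + 'I_n) := match x with
  | inl x => Some (inl x)
  | inr i => if unlift ord0 i is Some j then Some (inr j) else None end.
pose s' (x : option (V + 'I_n)) : option V + 'I_n := match x with
  | None => inl None | Some (inl x) => inl (Some x) | Some (inr j) => inr j end.
have [psi Hpsi] := IH _ (frename (s' \o s) phi).
exists (pEx psi) => N v /=; split=> [[m /Hpsi[w]]|[w satw]].
  rewrite sat_frename => satw.
  exists (fun i => if unlift ord0 i is Some j then w j else m).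
  congr (sat phi _): satw; apply/funext => -[x|i] //=.
  by rewrite /s /=; case: (unlift ord0 i).
exists (w ord0); apply/Hpsi; exists (fun j => w (lift ord0 j)).
rewrite sat_frename; congr (sat phi _): satw; apply/funext => -[x|i] //=.
by rewrite /s /=; case: unliftP => [j|] ->.
Qed.

(** A formula mentions finitely many variables, so it can be quantified
    existentially over an arbitrary set of them. *)
Lemma ex_closure L V W (phi : pformula L (V + W)) : exists psi : pformula L V,
  forall (N : structure L) (v : V -> N),
    sat psi v <-> exists w : W -> N, sat phi (join v w).
Proof.
have [s Hs] := support_exists phi.
pose sW : seq {classic W} :=
  pmap (fun x : {classic V + W} =>
    if (x : V + W) is inr y then Some (y : {classic W}) else None) s.
have [n [r [e re]]] := finite_names sW.
have [psi Hpsi] :=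
  ex_closure_ord (frename (fun x => match x with inl x => inl x | inr y => inr (r y) end) phi).
exists psi => N v; split=> [/Hpsi[w]|[w satw]].
  rewrite sat_frename => satw; exists (w \o r); congr (sat phi _): satw.
  by apply/funext => -[].
apply/Hpsi; exists (w \o e); rewrite sat_frename.
move: satw; apply: Hs => -[x|y] //= ys.
have ysW : (y : {classic W}) \in sW.
  by rewrite mem_pmap; apply/mapP; exists (inr y).
by rewrite (re _ ysW).
Qed.

Definition bigand L V (s : seq (pformula L V)) : pformula L V :=
  foldr (@pAnd L V) pTop s.

Lemma sat_bigand L (N : structure L) V (s : seq {classic pformula L V}) (v : V -> N) :
  sat (bigand s) v <-> forall phi : {classic pformula L V}, phi \in s -> sat phi v.
Proof.
elim: s => [|p s IH] //=; split.
  by move=> [satp /IH sats] phi; rewrite inE => /orP[/eqP->|/sats].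
move=> sats; split; first by apply: sats; rewrite inE eqxx.
by apply/IH => phi phis; apply: sats; rewrite inE phis orbT.
Qed.

(** * Ultraproducts and witnesses of failure in existentially closed models *)

Section Ultrapower.
Variables (L : signature) (M : structure L) (I : Type) (U : set_system I).
Context {FU : UltraFilter U}.

Lemma ultra_or (A B : set I) : U (A `|` B) -> U A \/ U B.
Proof.
move=> UAB; have [|UnA] := in_ultra_setVsetC A FU; [by left|right].
by apply: filterS (filterI UAB UnA) => i [[]].
Qed.

(** The elements of the ultrapower are classes of functions modulo U. *)
Definition uclass (f : I -> M) : set (I -> M) := [set g | U [set i | f i = g i]].
Definition ucarrier := {C : set (I -> M) | exists f, C = uclass f}.

Definition ucls (f : I -> M) : ucarrier :=
  exist _ (uclass f) (ex_intro _ f erefl).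
Definition urep (C : ucarrier) : I -> M := projT1 (cid (projT2 C)).

Lemma urepK C : ucls (urep C) = C.
Proof.
rewrite /ucls /urep; case: (cid _) => f /=; case: C => C /= hC E.
by apply: eq_exist.
Qed.

Lemma ucls_eq f g : ucls f = ucls g <-> U [set i | f i = g i].
Proof.
split=> [[E]|Ufg].
  have : uclass g g by exact: filterE.
  by rewrite -E.
apply: eq_exist; apply/seteqP; split=> h Uh.
  by apply: filterS (filterI Ufg Uh) => i /= [->].
by apply: filterS (filterI Ufg Uh) => i /= [->].
Qed.

Lemma urep_cls f : U [set i | urep (ucls f) i = f i].
Proof. by apply/ucls_eq; rewrite urepK. Qed.

Definition upower : structure L := @Structure L ucarrier
  (let: inhabits m := carrier_inhabited M in inhabits (ucls (fun=> m)))
  (fun f u => ucls (fun i => fint (f := f) (fun j => urep (u j) i)))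
  (fun r u => U [set i | rint (r := r) (fun j => urep (u j) i)]).

Lemma ultra_forall n (P : 'I_n -> set I) :
  (forall j, U (P j)) -> U [set i | forall j, P j i].
Proof. by move=> UP; exact: (@filter_forall I 'I_n P U _ UP). Qed.

Lemma eval_upower V (t : term L V) (v : V -> upower) :
  eval v t = ucls (fun i => eval (fun x => urep (v x) i) t).
Proof.
elim: t => [x|f ts IH] /=; first by rewrite -[LHS]urepK.
apply/ucls_eq; apply: filterS (ultra_forall
  (fun j => urep_cls (fun i => eval (fun x => urep (v x) i) (ts j)))).
by move=> i Hi /=; congr (fint _); apply/funext => j; rewrite IH Hi.
Qed.

(** The theorem of Los, for positive formulas. *)
Lemma sat_upower V (phi : pformula L V) (v : V -> upower) :
  sat phi v <-> U [set i | sat phi (fun x => urep (v x) i)].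
Proof.
elim: phi v => {V}.
- by move=> V v; split=> // _; exact: filterE.
- by move=> V v; split=> // /filter_ex[].
- by move=> V t u v /=; rewrite !eval_upower; exact: ucls_eq.
- move=> V r ts v /=.
  have UE := ultra_forall
    (fun j => urep_cls (fun i => eval (fun x => urep (v x) i) (ts j))).
  split=> H; apply: filterS (filterI H UE) => i /= [satr E];
    by congr (rint _): satr; apply/funext => j; rewrite eval_upower E.
- move=> V p IHp q IHq v /=; split=> [[/IHp Up /IHq Uq]|H].
    exact: filterI.
  by split; [apply/IHp|apply/IHq]; apply: filterS H => i [].
- move=> V p IHp q IHq v /=; split=> [[/IHp|/IHq]|].
  + by apply: filterS => i; left.
  + by apply: filterS => i; right.
  + by move=> /ultra_or[/IHp|/IHq]; [left|right].
- move=> V p IH v /=; split=> [[m /IH]|H].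
    apply: filterS => i satm; exists (urep m i).
    by congr (sat p _): satm; apply/funext => -[].
  have /choice[f Hf] (i : I) : exists m, (exists m, sat p (oapp (fun x => urep (v x) i) m)) ->
      sat p (oapp (fun x => urep (v x) i) m).
    have [m0] := carrier_inhabited M.
    have [[m]|no] := pselect (exists m, sat p (oapp (fun x => urep (v x) i) m)).
      by exists m.
    by exists m0.
  exists (ucls f); apply/IH; apply: filterS (filterI H (urep_cls f)) => i /= [/Hf + fi].
  by congr (sat p _); apply/funext => -[].
Qed.

Lemma upower_model (T : theory L) : model T M -> model T upower.
Proof.
move=> MT s Ts v /sat_upower H; apply/sat_upower.
by apply: filterS H => i; exact: MT.
Qed.

End Ultrapower.

(** A positive formula fails in a positively existentially closed model only
    when some positive formula true there contradicts it.  Otherwise every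
    positive formula delta true at id (an element of the positive diagram)
    holds together with phi at some g delta; an ultraproduct of these g over
    the diagram is a homomorphism to an ultrapower making phi true. *)
Lemma neg_witness L (T : theory L) (M : structure L) (phi : pformula L M) :
  pec T M -> ~ sat phi id ->
  exists2 delta : pformula L M, sat delta id &
    forall g : M -> M, sat delta g -> ~ sat phi g.
Proof.
move=> [MT Mpec] nphi; apply: contrapT => nodelta.
pose Diag := {delta : pformula L M | sat delta id}.
have /choice[g Hg] (i : Diag) : exists g : M -> M, sat (sval i) g /\ sat phi g.
  apply: contrapT => no; apply: nodelta; exists (sval i); first exact: (svalP i).
  by move=> g satg satphi; apply: no; exists g.
pose B (i : Diag) : set Diag := [set j | sat (sval i) (g j)].
have FB : Filter (filter_from setT B).
  apply: filter_fromT_filter; first by exists (exist _ pTop I).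
  move=> i j; exists (exist _ (pAnd (sval i) (sval j)) (conj (svalP i) (svalP j))).
  by move=> h [].
have PB : ProperFilter (filter_from setT B).
  by apply: filter_from_proper => i _; exists i; exact: (Hg i).1.
have [U [UU BU]] := ultraFilterLemma PB.
have UB i : U (B i) by apply: BU; exists i.
pose h (m : M) : upower M U := ucls U (fun i => g i m).
have hrep (m : M) : U [set i | urep (h m) i = g i m] by exact: urep_cls.
have hhom : hom h.
  split=> [f u|r u satr] /=.
    have UE := ultra_forall (FU := UU) (fun j => hrep (u j)).
    pose i0 : Diag := exist _ (pEq (tApp f (fun j => tVar (u j))) (tVar (fint u))) erefl.
    apply/ucls_eq; apply: filterS (filterI UE (UB i0)) => i [Ei Bi].
    rewrite /B /= in Bi; rewrite /= -Bi.
    by congr (fint _); apply/funext => j; rewrite /= Ei.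
  have UE := ultra_forall (FU := UU) (fun j => hrep (u j)).
  pose i0 : Diag := exist _ (pRel r (fun j => tVar (u j))) satr.
  apply: filterS (filterI UE (UB i0)) => i [Ei Bi].
  by congr (rint _): Bi; apply/funext => j; rewrite /= Ei.
have [s Hs] := support_exists phi.
apply/nphi/(Mpec _ h (upower_model MT) hhom)/sat_upower.
have : U [set i | forall x : {classic M}, x \in s -> urep (h x) i = g i x].
  elim: s {Hs} => [|x s IH]; first exact: filterE.
  apply: filterS (filterI (hrep x) IH) => i [Ex Es] y.
  by rewrite inE => /orP[/eqP->|/Es].
apply: filterS => i Ei; apply: Hs (Hg i).2 => x xs.
by rewrite /= Ei.
Qed.

(** * Small sets *)

Lemma card_le_typeP V W : [set: V] #<= [set: W] <-> exists f : V -> W, injective f.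
Proof.
split=> [/card_leP[f]|[f finj]].
  pose mk (x : V) : set_type [set: V] := SigSub (mem_set (Logic.I : [set: V] x)).
  exists (fun x => val (f (mk x))) => x y /val_inj fxy.
  have /(congr1 val) // : mk x = mk y.
  by apply: (@inj _ _ _ f) fxy; rewrite inE.
have /injfunPex[g] : exists2 f : V -> W, set_fun setT setT f & set_inj setT f.
  by exists f => // x y _ _ /finj.
exact: inj_card_le.
Qed.

Section Small.
Variable kappa : Type.

Lemma small_le V W (A : set V) (B : set W) : A #<= B -> small kappa B -> small kappa A.
Proof.
move=> AB [Bk nkB]; split; first exact: card_le_trans AB Bk.
by move=> kA; apply: nkB; exact: card_le_trans kA AB.
Qed.

Lemma small_inj V W (f : V -> W) : injective f ->
  small kappa [set: W] -> small kappa [set: V].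
Proof. by move=> finj; apply: small_le; apply/card_le_typeP; exists f. Qed.

Lemma small_sig V (A : set V) : small kappa A -> small kappa [set: {x | A x}].
Proof.
apply: small_le; have /injfunPex[g] : exists2 f : {x | A x} -> V,
    set_fun setT A f & set_inj setT f.
  exists sval; first by move=> [].
  by move=> [x Ax] [y Ay] _ _ /= xy; apply: eq_exist.
exact: inj_card_le.
Qed.

Hypothesis nat_small : small kappa [set: nat].

Lemma small_countType (V : countType) : small kappa [set: V].
Proof. exact: small_inj (pcan_inj (@pickleK V)) nat_small. Qed.

(** An infinite D absorbs a countable set: a copy of nat inside D makes room
    by moving to its even places, and V goes to the odd ones. *)
Lemma small_sum D (V : countType) : small kappa [set: D] -> small kappa [set: (D + V)%type].
Proof.
move=> Dsmall; have [Dfin|] := pselect (finite_set [set: D]).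
  have /card_le_typeP[f finj] : [set: D] #<= [set: nat] := finite_set_countable Dfin.
  apply: (@small_inj _ (nat + V)%type 
    (fun x => match x with inl y => inl (f y) | inr z => inr z end)).
    by move=> [x|x] [y|y] // [] => [/finj|] ->.
  exact: small_countType.
move=> /infiniteP/card_le_typeP[f finj].
pose g (x : D + V) : D := match x with
  | inl x => if pselect (exists n, f n = x) is left h then f (projT1 (cid h)).*2 else x
  | inr v => f (pickle v).*2.+1 end.
apply: (@small_inj _ _ g) Dsmall => -[x|v] [y|w] /=.
- case: pselect => [hx|hx]; case: pselect => [hy|hy].
  + by case: cid => m /= <-; case: cid => n /= <- /finj/double_inj ->.
  + by move=> E; case: hy; eexists; exact: E.
  + by move=> E; case: hx; eexists; symmetry; exact: E.
  + by move=> ->.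
- case: pselect => hx.
    by move=> /finj /(congr1 odd) /=; rewrite !odd_double.
  by move=> E; case: hx; eexists; symmetry; exact: E.
- case: pselect => hx.
    by move=> /finj /(congr1 odd) /=; rewrite !odd_double.
  by move=> E; case: hx; eexists; exact: E.
- by move=> /finj [] /double_inj /(pcan_inj (@pickleK V)) ->.
Qed.

End Small.

(** * Compactness of the monster model *)

(** Every positive formula with parameters named by d is, up to renaming
    the finitely many parameters that it mentions, one of the formulas
    quantified over in types and in saturation; this also holds after the
    parameters are carried along h to another structure. *)
Lemma Mformula_of L (M : structure L) D (d : D -> M) V
    (phi : pformula L (V + D)) : exists mf : Mformula M V,
  (forall j, range d (mpar mf j)) /\
  forall (N : structure L) (h : M -> N) v,
    sat (mform mf) (join v (h \o mpar mf)) <-> sat phi (join v (h \o d)).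
Proof.
have [s Hs] := support_exists phi.
pose sD : seq {classic D} := pmap (fun x : {classic V + D} =>
  if (x : V + D) is inr y then Some (y : {classic D}) else None) s.
have [n [r [e re]]] := finite_names sD.
pose t (x : V + D) := match x with inl v => inl v | inr y => inr (r y) end.
exists (@MFormula _ _ _ n (frename t phi) (d \o e)); split=> /=.
  by move=> j; exists (e j).
move=> N h v; rewrite /= sat_frename.
have E (x : {classic V + D}) : x \in s ->
    (join v (h \o (d \o e)) \o t) x = join v (h \o d) x.
  case: x => [x|y] //= ys.
  have yD : (y : {classic D}) \in sD.
    by rewrite mem_pmap; apply/mapP; exists (inr y).
  by rewrite /= (re _ yD).
by split; apply: Hs => x xs; rewrite E.
Qed.

(** Lifts a finite set of formulas along a map or a union of sets, as needed
    to use finite satisfiability. *)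
Lemma seq_choice A B (R : A -> B -> Prop) (t : seq {classic B}) :
  (forall y, y \in t -> exists x, R x y) ->
  exists s : seq {classic A}, (forall x, x \in s -> exists y, R x y) /\
    forall y, y \in t -> exists2 x, x \in s & R x y.
Proof.
elim: t => [|y t IH] tR; first by exists [::].
have [|s [sR ts]] := IH; first by move=> z zt; apply: tR; rewrite inE zt orbT.
have [x Rxy] := tR y (mem_head _ _).
exists ((x : {classic A}) :: s); split.
  by move=> z; rewrite inE => /orP[/eqP->|/sR//]; exists y.
move=> z; rewrite inE => /orP[/eqP->|/ts[w ws Rwz]].
  by exists x; rewrite ?mem_head.
by exists w; rewrite // inE ws orbT.
Qed.

Section Compactness.
Variables (L : signature) (kappa : Type) (M : structure L).
Hypotheses (nat_small : small kappa [set: nat]) (Msat : saturated kappa M).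

Lemma realize D (d : D -> M) V (Sigma : set (pformula L (V + D))) :
  small kappa [set: D] -> small kappa [set: V] ->
  (forall s : seq {classic pformula L (V + D)}, (forall phi, phi \in s -> Sigma phi) ->
    exists v, forall phi, phi \in s -> sat phi (join v d)) ->
  exists v, forall phi, Sigma phi -> sat phi (join v d).
Proof.
move=> Ds Vs fin; have [F HF] := choice (@Mformula_of L M D d V).
have Asmall : small kappa (range d) by exact: small_le (card_image_le _ _) Ds.
have [||v Hv] := Msat (A := range d) (Sigma := F @` Sigma) Vs Asmall.
- by move=> _ [phi _ <-]; exact: (HF phi).1.
- move=> F0 /(@finite_seqP {classic Mformula M V})[t ->] tS.
  have [m /tS[phi Sphi <-]|s [sR st]] := @seq_choice _ _ (fun phi m => Sigma phi /\ F phi = m) t.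
    by exists phi.
  have [|v Hv] := fin s; first by move=> phi /sR[m []].
  exists v => m /= mt; have [phi phis [_ <-]] := st m mt.
  by apply/((HF phi).2 _ id); exact: Hv.
- exists v => phi Sphi; apply/((HF phi).2 _ id); apply: Hv.
  by exists phi.
Qed.

(** A set of tuples of M is type-definable over d when it is cut out by
    positive formulas with parameters among the values of d. *)
Definition tdef D (d : D -> M) V (P : (V -> M) -> Prop) :=
  exists Sigma : set (pformula L (V + D)),
    forall v, P v <-> forall phi, Sigma phi -> sat phi (join v d).

Lemma tdef_iff D (d : D -> M) V (P Q : (V -> M) -> Prop) :
  (forall v, P v <-> Q v) -> tdef d P -> tdef d Q.
Proof. by move=> PQ [S HS]; exists S => v; rewrite -PQ. Qed.

Lemma tdef_sat D (d : D -> M) V (phi : pformula L V) : tdef d (fun v => sat phi v).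
Proof.
exists [set frename inl phi] => v; split=> [satv _ ->|/(_ _ erefl)];
  by rewrite sat_frename.
Qed.

Lemma tdef_all D (d : D -> M) V J (P : J -> (V -> M) -> Prop) :
  (forall j, tdef d (P j)) -> tdef d (fun v => forall j, P j v).
Proof.
move=> /choice[S HS]; exists (\bigcup_j S j) => v; split.
  by move=> Pv phi [j _ Sphi]; exact: (HS j v).1.
by move=> Sv j; apply/HS => phi Sphi; apply: Sv; exists j.
Qed.

Lemma tdef_and D (d : D -> M) V (P Q : (V -> M) -> Prop) :
  tdef d P -> tdef d Q -> tdef d (fun v => P v /\ Q v).
Proof.
move=> Pd Qd; have := @tdef_all _ d _ bool (fun b => if b then P else Q).
move=> /(_ (fun b => match b with true => Pd | false => Qd end)).
by apply: tdef_iff => v; split=> [PQ|[Pv Qv] []//]; split;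
  [exact: (PQ true)|exact: (PQ false)].
Qed.

(** The disjunctions of a formula defining P with one defining Q: a tuple
    outside both sets falsifies one formula of each kind. *)
Lemma tdef_or D (d : D -> M) V (P Q : (V -> M) -> Prop) :
  tdef d P -> tdef d Q -> tdef d (fun v => P v \/ Q v).
Proof.
move=> [S HS] [S' HS']; exists [set pOr phi psi | phi in S & psi in S'] => v; split.
  by move=> PQ _ [phi Sphi] [psi Spsi] <- /=; case: PQ => [/HS|/HS'] H; [left|right]; apply: H.
move=> H; apply: contrapT => /not_orP[nP nQ].
move: nP nQ; rewrite HS HS'.
move=> /existsNP[phi /not_implyP[Sphi nphi]] /existsNP[psi /not_implyP[Spsi npsi]].
by case: (H (pOr phi psi)) => //; exists phi => //; exists psi.
Qed.

Lemma tdef_ex_fin D (d : D -> M) V (J : finType) (P : J -> (V -> M) -> Prop) :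
  (forall j, tdef d (P j)) -> tdef d (fun v => exists j, P j v).
Proof.
move=> Pd.
suff : tdef d (fun v => exists2 j, j \in enum J & P j v).
  apply: tdef_iff => v; split=> [[j _ Pj]|[j Pj]]; first by exists j.
  by exists j; rewrite // mem_enum.
elim: (enum J) => [|i s IH].
  by apply: tdef_iff (tdef_sat d pBot) => v; split=> // -[].
apply: tdef_iff (tdef_or (Pd i) IH) => v; split=> [[Pi|[j js Pj]]|[j]].
- by exists i; rewrite ?mem_head.
- by exists j; rewrite // inE js orbT.
- by rewrite inE => /orP[/eqP->|js] Pj; [left|right; exists j].
Qed.

(** Some variables become parameters, named by u. *)
Lemma tdef_subst D (d : D -> M) V W U (u : U -> M) (s : V -> W + U)
    (P : (V -> M) -> Prop) :
  tdef d P -> tdef (join d u) (fun w : W -> M => P (join w u \o s)).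
Proof.
pose t (x : V + D) : W + (D + U) := match x with
  | inl x => match s x with inl w => inl w | inr y => inr (inr y) end
  | inr y => inr (inl y) end.
move=> [S HS]; exists (frename t @` S) => w; rewrite HS.
have E : join w (join d u) \o t = join (join w u \o s) d.
  by apply/funext => -[x|y] //=; rewrite /t /=; case: (s x).
split=> [H _ [phi Sphi <-]|H phi Sphi]; first by rewrite sat_frename E; exact: H.
by rewrite -E -sat_frename; apply: H; exists phi.
Qed.

Lemma tdef_comp D (d : D -> M) V W (s : V -> W) (P : (V -> M) -> Prop) :
  tdef d P -> tdef d (fun w : W -> M => P (w \o s)).
Proof.
pose t (x : V + D) : W + D := match x with inl x => inl (s x) | inr y => inr y end.
move=> [S HS]; exists (frename t @` S) => w; rewrite HS.
have E : join w d \o t = join (w \o s) d by apply/funext => -[].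
split=> [H _ [phi Sphi <-]|H phi Sphi]; first by rewrite sat_frename E; exact: H.
by rewrite -E -sat_frename; apply: H; exists phi.
Qed.

Lemma tdef_fip D (d : D -> M) V J (P : J -> (V -> M) -> Prop) :
  small kappa [set: D] -> small kappa [set: V] -> (forall j, tdef d (P j)) ->
  (forall s : seq {classic J}, exists v, forall j, j \in s -> P j v) ->
  exists v, forall j, P j v.
Proof.
move=> Ds Vs /choice[S HS] fin.
have [|v Hv] := realize (d := d) (Sigma := \bigcup_j S j) Ds Vs.
  move=> s sS; have [phi /sS[j _ Sj]|t [_ Ht]] := seq_choice (R := S) (t := s).
    by exists j.
  have [v Hv] := fin t; exists v => phi /Ht[j jt Sj].
  exact: (HS j v).1 (Hv j jt) phi Sj.
by exists v => j; apply/HS => phi Sphi; apply: Hv; exists j.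
Qed.

(** Saturation makes type-definable sets closed under projection: v extends
    to a realization as soon as every finite part of the defining set can be
    realized over v. *)
Lemma tdef_ex D (d : D -> M) (V : countType) W (P : (V + W -> M) -> Prop) :
  small kappa [set: D] -> small kappa [set: W] ->
  tdef d P -> tdef d (fun v : V -> M => exists w : W -> M, P (join v w)).
Proof.
move=> Ds Ws [S HS].
pose t (x : (V + W) + D) : (V + D) + W := match x with
  | inl (inl x) => inl (inl x) | inl (inr y) => inr y | inr z => inl (inr z) end.
have /choice[C HC] (phi : pformula L ((V + W) + D)) := ex_closure (frename t phi).
have Et v w : join (join v d) w \o t = join (join v w) d by apply/funext => -[[]|].
exists [set C (bigand s) | s in [set s : seq {classic pformula L ((V + W) + D)} |
  forall phi, phi \in s -> S phi]] => v; split.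
  move=> [w /HS Pw] _ [s sS <-]; apply/HC; exists w; rewrite sat_frename Et.
  by apply/sat_bigand => phi /sS; exact: Pw.
move=> H.
pose t' (x : (V + W) + D) : W + (D + V) := match x with
  | inl (inl x) => inr (inr x) | inl (inr y) => inl y | inr z => inr (inl z) end.
have Et' (w : W -> M) : join w (join d v) \o t' = join (join v w) d by apply/funext => -[[]|].
have [|w Hw] := realize (d := join d v) (Sigma := frename t' @` S)
    (small_sum nat_small V Ds) Ws; last first.
  exists w; apply/HS => phi Sphi; rewrite -Et' -sat_frename; apply: Hw.
  by exists phi.
move=> s sS.
have [psi /sS[phi Sphi <-]|s' [s'R ss']] :=
  @seq_choice _ _ (fun phi psi => S phi /\ frename t' phi = psi) s.
  by exists phi.
have s'S phi : phi \in s' -> S phi by move=> /s'R[psi []].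
have /HC[w] : sat (C (bigand s')) (join v d) by apply: H; exists s'.
rewrite sat_frename Et => /sat_bigand Hw.
by exists w => psi /ss'[phi /Hw ? [_ <-]]; rewrite sat_frename Et'.
Qed.

End Compactness.

(** * Inp-patterns realized in the monster model *)

Definition rmap X Y Z (f : Y -> Z) (s : X + Y) : X + Z :=
  match s with inl x => inl x | inr y => inr (f y) end.

Lemma join_rmap X Y Z W (f : Y -> Z) (x : X -> W) (z : Z -> W) :
  join x z \o rmap f = join x (z \o f).
Proof. by apply/funext => -[]. Qed.

Definition swap X Y (s : X + Y) : Y + X :=
  match s with inl x => inr x | inr y => inl y end.

Lemma join_swap X Y W (x : X -> W) (y : Y -> W) : join y x \o @swap X Y = join x y.
Proof. by apply/funext => -[]. Qed.

(** x realizes tp(a/E): each element of E is a variable interpreted by itself,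
    which replaces the finite tuples of parameters of tp (see tp_sat). *)
Definition tp_le L (M : structure L) (E : set M) X (a x : X -> M) :=
  forall phi : pformula L (X + {e | E e}), sat phi (join a sval) -> sat phi (join x sval).

Lemma tp_le_comp L (M : structure L) (E : set M) X X' (e : X' -> X) (a x : X -> M) :
  tp_le E a x -> tp_le E (a \o e) (x \o e).
Proof.
move=> ax phi; pose t (s : X' + {e | E e}) : X + {e | E e} :=
  match s with inl x => inl (e x) | inr y => inr y end.
have Et (z : X -> M) : join (z \o e) sval = join z sval \o t by apply/funext => -[].
by rewrite !Et -!sat_frename; exact: ax.
Qed.

Lemma tp_sat L (M N : structure L) (E : set M) (h : M -> N) X (a : X -> M) (x : X -> N) :
  (forall mf, tp a E mf -> sat (mform mf) (join x (h \o mpar mf))) <->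
  (forall phi : pformula L (X + {e | E e}),
    sat phi (join a sval) -> sat phi (join x (h \o sval))).
Proof.
split=> [H phi sata|H mf [mE mfa]].
  have [mf [mfr mfP]] := Mformula_of (sval : {e | E e} -> M) phi.
  apply/mfP/H; split; last exact/(mfP _ id).
  by move=> j; have [[e Ee] _ <-] := mfr j.
pose t (j : 'I_(mlen mf)) : {e | E e} := exist _ (mpar mf j) (mE j).
have := H (frename (rmap t) (mform mf)); rewrite !sat_frename !join_rmap; exact.
Qed.

(** Together, row_inconsistent and row_satisfies say that psi witnesses the
    inconsistency of the instances of phi along one row of an inp-pattern. *)
Definition row_inconsistent L (M : structure L) X Y (phi : pformula L (X + Y))
    p (psi : pformula L ('I_p * Y)) :=
  ~ exists (x : X -> M) (y : 'I_p -> Y -> M),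
      sat psi (fun q => y q.1 q.2) /\ forall i, sat phi (join x (y i)).

Definition row_satisfies L (M : structure L) Y p (psi : pformula L ('I_p * Y))
    (c : nat -> Y -> M) :=
  forall s : 'I_p -> nat, (forall i j : 'I_p, i < j -> s i < s j) ->
    sat psi (fun q => c (s q.1) q.2).

(** A variant of inp-patterns in tp(a/E): the tuples y may be infinite, which
    allows arbitrarily many parameters in the formulas, and each path is
    realized inside M. *)
Definition has_pattern L (M : structure L) (E : set M) X (a : X -> M) (K Y : Type) :=
  exists (c : K -> nat -> Y -> M) (phi : K -> pformula L (X + Y)),
    (forall al, exists p (psi : pformula L ('I_p * Y)),
      row_inconsistent M (phi al) psi /\ row_satisfies psi (c al)) /\
    forall f : K -> nat, exists x, tp_le E a x /\
      forall al, sat (phi al) (join x (c al (f al))).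

Section Patterns.
Variables (L : signature) (T : theory L) (kappa : Type) (M : structure L).
Hypotheses (nat_small : small kappa [set: nat]) (Msat : saturated kappa M).
Hypothesis Mpec : pec T M.
Variables (E : set M) (E_small : small kappa E).

(** Each path is realized in some continuation of M.  Its finite parts are
    then realized in M, which reflects positive formulas, and saturation
    realizes the whole path in M. *)
Lemma has_pattern_of_inp X (a : X -> M) (K : countType) :
  small kappa [set: X] -> inhabited (inp_pattern T (tp a E) K) ->
  has_pattern E a K nat.
Proof.
move=> Xs [[len arr form incons cons]]; have [m0] := carrier_inhabited M.
pose c al i (j : nat) : M := if insub j is Some j' then arr al i j' else m0.
have cE al i : c al i \o val = arr al i.
  by apply/funext => j; rewrite /c /= valK.
exists c, (fun al => frename (rmap val) (form al)); split.
  move=> al; have [p [psi [H1 H2]]] := incons al.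
  exists p, (frename (fun q => (q.1, val q.2)) psi); split.
    move=> [x [y [saty satx]]]; apply: H1; exists x, (fun i => y i \o val).
    split; first by move: saty; rewrite sat_frename.
    by move=> i; have := satx i; rewrite sat_frename join_rmap.
  move=> s Hs; rewrite sat_frename; move: (H2 s Hs); congr (sat psi _).
  by apply/funext => -[i j] /=; rewrite -cE.
move=> f; have [N [h [x [NT hh HN]]]] := cons f.
pose D := ({e | E e} + K * nat)%type.
pose d : D -> M := join sval (fun q => c q.1 (f q.1) q.2).
pose tE (phi : pformula L (X + {e | E e})) : pformula L (X + D) :=
  frename (rmap inl) phi.
pose tA al : pformula L (X + D) := frename (rmap (fun j => inr (al, val j))) (form al).
have dE : d \o inl = sval by [].
have dA al : d \o (fun j : 'I_(len al) => inr (al, val j)) = arr al (f al).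
  by apply/funext => j; rewrite -cE.
have Ds : small kappa [set: D].
  exact: (small_sum nat_small (K * nat)%type (small_sig E_small)).
have [s Hs|v Hv] := realize Msat (d := d)
    (Sigma := tE @` [set phi | sat phi (join a sval)] `|` range tA) Ds Xs.
  have HNs phi : phi \in s -> sat (phi : pformula L (X + D)) (join x (h \o d)).
    move=> /Hs[[psi satpsi <-]|[al _ <-]]; rewrite sat_frename join_rmap -compA.
      rewrite dE; apply: (proj1 (tp_sat E h a x)) satpsi => mf mftp; apply: HN; by left.
    rewrite dA; have := HN (MFormula (form al) (arr al (f al))).
    by apply; right; exists al.
  have [psi Hpsi] := ex_closure (frename (@swap X D) (bigand s)).
  have [w] : exists w : X -> M, sat (frename (@swap X D) (bigand s)) (join d w).
    apply/Hpsi/(Mpec.2 _ _ NT hh)/Hpsi; exists x.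
    by rewrite sat_frename join_swap; apply/sat_bigand.
  by rewrite sat_frename join_swap => /sat_bigand Hw; exists w.
exists v; split=> [phi sata|al].
  have := Hv (tE phi); rewrite sat_frename join_rmap dE; apply.
  by left; exists phi.
have := Hv (tA al); rewrite !sat_frename !join_rmap dA cE; apply.
by right; exists al.
Qed.

(** On the row al, the formulas phi al and psi mention finitely many elements
    of Y, and the remaining ones are discarded. *)
Lemma inp_of_has_pattern X (a : X -> M) K Y :
  has_pattern E a K Y -> inhabited (inp_pattern T (tp a E) K).
Proof.
move=> [c [phi [incons cons]]].
have names al : exists t : {n & (Y -> 'I_n) * ('I_n -> Y)}%type,
  (forall (x : X -> M) (y : Y -> M),
    sat (phi al) (join x (y \o (projT2 t).2 \o (projT2 t).1)) <->
    sat (phi al) (join x y)) /\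
  exists p (psi : pformula L ('I_p * Y)),
    row_inconsistent M (phi al) psi /\
    row_satisfies psi (fun i => c al i \o (projT2 t).2 \o (projT2 t).1).
  have [p [psi [H1 H2]]] := incons al.
  have [s1 Hs1] := support_exists (phi al); have [s2 Hs2] := support_exists psi.
  pose s1' : seq {classic Y} := pmap (fun x : {classic X + Y} =>
    if (x : X + Y) is inr y then Some (y : {classic Y}) else None) s1.
  pose s2' : seq {classic Y} := map (fun q : {classic 'I_p * Y} => (q : 'I_p * Y).2) s2.
  have [n [r [e re]]] := finite_names (s1' ++ s2').
  exists (existT _ n (r, e)); split=> /= [x y|].
    have Exy (z : {classic X + Y}) : z \in s1 -> join x (y \o e \o r) z = join x y z.
      case: z => [//|z zs].
      rewrite /= re // mem_cat; apply/orP; left.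
      by rewrite mem_pmap; apply/mapP; exists (inr z).
    by split; apply: Hs1 => z zs; rewrite Exy.
  exists p, psi; split=> // s /H2; apply: Hs2 => -[i y] qs /=.
  by rewrite re // mem_cat; apply/orP; right; apply/mapP; exists (i, y).
have [t Ht] := choice names.
apply: inhabits.
apply: (@InpPattern L T M X (tp a E) K (fun al => projT1 (t al))
  (fun al i => c al i \o (projT2 (t al)).2)
  (fun al => frename (rmap (projT2 (t al)).1) (phi al))).
  move=> al; have [_ [p [psi [H1 H2]]]] := Ht al.
  exists p, (frename (fun q => (q.1, (projT2 (t al)).1 q.2)) psi); split.
    move=> [x [y [saty satx]]]; apply: H1.
    exists x, (fun i => y i \o (projT2 (t al)).1).
    split; first by move: saty; rewrite sat_frename.
    by move=> i; have := satx i; rewrite sat_frename join_rmap.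
  by move=> s Hs; rewrite sat_frename; exact: H2.
move=> f; have [x [xa Hx]] := cons f.
exists M, id, x; split => //; first exact: Mpec.1.
move=> mf [mftp|[al _ <-]].
  by apply: (proj2 (tp_sat E id a x)) mf mftp.
by rewrite /= sat_frename join_rmap; apply/(Ht al).1.
Qed.

End Patterns.

(** * Replacing a row by one with a common solution *)

Definition increasing (s : nat -> nat) := forall i j, i < j -> s i < s j.

Lemma increasing_extension p (s : 'I_p.+1 -> nat) :
  (forall i j : 'I_p.+1, i < j -> s i < s j) ->
  exists2 s', increasing s' & forall i : 'I_p.+1, s' i = s i.
Proof.
move=> Hs; exists (fun n => if n < p.+1 then s (inord n) else s ord_max + n).
  move=> i j ij; case: (ltnP i p.+1) => ip; case: (ltnP j p.+1) => jp.
  - by apply: (Hs (inord i) (inord j)); rewrite !inordK.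
  - have ile : s (inord i) <= s ord_max.
      have [ilt|ige] := ltnP (inord i : 'I_p.+1) (ord_max : 'I_p.+1).
        exact/ltnW/Hs.
      suff -> : (inord i : 'I_p.+1) = ord_max by [].
      by apply/val_inj/eqP; rewrite eqn_leq ige andbT -ltnS ltn_ord.
    by apply: leq_ltn_trans ile _; rewrite -[X in X < _]addn0 ltn_add2l (leq_trans _ jp).
  - by have := leq_trans (ltn_trans ij jp) ip; rewrite ltnn.
  - by rewrite ltn_add2l.
by move=> i; rewrite ltn_ord inord_val.
Qed.

Lemma seq_bound (s : seq nat) : exists q, forall n, n \in s -> n <= q.
Proof.
elim: s => [|m s [q Hq]]; first by exists 0.
exists (maxn m q) => n; rewrite inE => /orP[/eqP->|/Hq nq]; first exact: leq_maxl.
exact: leq_trans nq (leq_maxr _ _).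
Qed.

Section Rule.
Variables (L : signature) (T : theory L) (kappa : Type) (M : structure L).
Hypotheses (nat_small : small kappa [set: nat]) (Msat : saturated kappa M).
Hypothesis Mpec : pec T M.

Lemma tdef_par D (d : D -> M) V (phi : pformula L (V + D)) :
  tdef d (fun v => sat phi (join v d)).
Proof. by exists [set phi] => v; split=> [? _ ->//|]; apply. Qed.

(** When no row satisfying Psi has a common solution x of Theta, this failure
    has a finite reason: a consequence phi of Theta and a consequence of Psi
    on p entries contradict each other.  The parameters become variables of
    psi and phi (the summand M of Y + M); for the contradiction to persist at
    all values of these variables, psi includes the formula supplied by
    neg_witness and says that the p copies of the parameters agree. *)
Lemma row_contradiction (X Y : countType) D (d : D -> M)
    (Psi : (nat * Y -> M) -> Prop) (Theta : (X + Y -> M) -> Prop)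
    (c : nat * Y -> M) :
  small kappa [set: D] -> tdef d Psi -> tdef d Theta ->
  (forall c' s, increasing s -> Psi c' -> Psi (fun q => c' (s q.1, q.2))) ->
  Psi c ->
  (forall y x, Psi y -> ~ forall i, Theta (join x (fun j => y (i, j)))) ->
  exists (phi : pformula L (X + (Y + M))) p (psi : pformula L ('I_p * (Y + M))),
    [/\ row_inconsistent M phi psi,
        row_satisfies psi (fun i => join (fun j => c (i, j)) id) &
        forall x y, Theta (join x y) -> sat phi (join x (join y id))].
Proof.
move=> Ds [S1 HS1] [S2 HS2] Psi_shift Psic noy.
pose V := (nat * Y + X)%type.
pose J := ({psi | S1 psi} + nat * {theta | S2 theta})%type.
pose sub (i : nat) (z : X + Y) : V := match z with inl x => inr x | inr y => inl (i, y) end.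
pose P (j : J) (v : V -> M) := match j with
  | inl psi => sat (sval psi) (join (v \o inl) d)
  | inr th => sat (sval th.2) (join (v \o sub th.1) d) end.
have Pd j : tdef d (P j).
  case: j => [psi|th].
    exact: (tdef_comp inl (tdef_par d (sval psi))).
  exact: (tdef_comp (sub th.1) (tdef_par d (sval th.2))).
have joinV v i : v \o sub i = join (v \o inr) (fun j => v (inl (i, j))).
  by apply/funext => -[].
have [t Ht] : exists t : seq {classic J}, forall v, ~ forall j, j \in t -> P j v.
  apply: contrapT => not_t.
  have [|v Hv] := tdef_fip Msat Ds (small_countType nat_small V) Pd.
    move=> t; apply: contrapT => no; apply: not_t; exists t => v Hv.
    by apply: no; exists v.
  apply: (noy (v \o inl) (v \o inr)).
    by apply/HS1 => psi Spsi; exact: (Hv (inl (exist _ psi Spsi))).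
  move=> i; apply/HS2 => th Sth.
  by rewrite -joinV; exact: (Hv (inr (i, exist _ th Sth))).
pose F1 : seq {classic pformula L ((nat * Y) + D)} := pmap (fun j : {classic J} =>
  if (j : J) is inl psi then Some (sval psi : {classic _}) else None) t.
pose F2 : seq {classic pformula L ((X + Y) + D)} := pmap (fun j : {classic J} =>
  if (j : J) is inr th then Some (sval th.2 : {classic _}) else None) t.
pose idx : seq nat := pmap (fun j : {classic J} =>
  if (j : J) is inr th then Some th.1 else None) t.
have F1S psi : psi \in F1 -> S1 psi.
  rewrite mem_pmap => /mapP[[[z Sz]|//] _ [->]]; exact: Sz.
have F2S th : th \in F2 -> S2 th.
  rewrite mem_pmap => /mapP[[//|[i [z Sz]]] _ [->]]; exact: Sz.
have [s1 Hs1] := support_exists (bigand F1).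
have [s2 Hs2] := support_exists (bigand F2).
pose idx1 : seq nat := pmap (fun z : {classic (nat * Y) + D} =>
  if (z : (nat * Y) + D) is inl w then Some w.1 else None) s1.
pose sD : seq {classic D} := pmap (fun z : {classic (X + Y) + D} =>
  if (z : (X + Y) + D) is inr w then Some (w : {classic D}) else None) s2.
have [q Hq] := seq_bound (idx ++ idx1).
(* What neg_witness refutes must be a formula in the parameters alone: chi
   quantifies over the row and over x.  The entries up to q include those at which
   Theta is used and those mentioned by F1. *)
have unsat (v : V -> M) : ~ (sat (bigand F1) (join (v \o inl) d) /\
    forall i : 'I_q.+1, sat (bigand F2) (join (v \o sub i) d)).
  move=> [/sat_bigand v1 v2]; apply: (Ht v) => -[psi|[i th]] jt /=.
    by apply: v1; rewrite mem_pmap; apply/mapP; exists (inl psi).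
  have iq : i < q.+1.
    rewrite ltnS; apply: Hq; rewrite mem_cat; apply/orP; left.
    by rewrite mem_pmap; apply/mapP; exists (inr (i, th)).
  have /sat_bigand := v2 (Ordinal iq); apply.
  by rewrite mem_pmap; apply/mapP; exists (inr (i, th)).
pose r1 (z : (nat * Y) + D) : M + V :=
  match z with inl w => inr (inl w) | inr e => inl (d e) end.
pose r2 i (z : (X + Y) + D) : M + V :=
  match z with inl w => inr (sub i w) | inr e => inl (d e) end.
have r1E (g : M -> M) v : join g v \o r1 = join (v \o inl) (g \o d).
  by apply/funext => -[].
have r2E (g : M -> M) v i : join g v \o r2 i = join (v \o sub i) (g \o d).
  by apply/funext => -[].
have [chi Hchi] := ex_closure (pAnd (frename r1 (bigand F1))
  (bigand [seq frename (r2 (i : 'I_q.+1)) (bigand F2) | i <- enum 'I_q.+1])).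
have chiP (g : M -> M) v : sat (bigand F1) (join (v \o inl) (g \o d)) ->
    (forall i : 'I_q.+1, sat (bigand F2) (join (v \o sub i) (g \o d))) -> sat chi g.
  move=> v1 v2; apply/Hchi; exists v => /=; rewrite sat_frename r1E; split=> //.
  elim: (enum _) => //= i s IH; split=> //.
  by rewrite sat_frename r2E.
have nchi : ~ sat chi id.
  move=> /Hchi[v] /=; rewrite sat_frename r1E => -[v1 v2]; apply: (unsat v).
  split=> // i; move: v2.
  have : i \in enum 'I_q.+1 by rewrite mem_enum.
  elim: (enum _) => //= j s IH; rewrite inE => /orP[/eqP <-|/IH Hi] [v2 v2s].
    by move: v2; rewrite sat_frename r2E.
  exact: Hi.
have [delta delta_id delta_chi] := neg_witness Mpec nchi.
pose rphi (z : (X + Y) + D) : X + (Y + M) := match z with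
  | inl (inl x) => inl x | inl (inr y) => inr (inl y) | inr e => inr (inr (d e)) end.
pose rpsi (z : (nat * Y) + D) : 'I_q.+1 * (Y + M) := match z with
  | inl w => (inord w.1, inl w.2) | inr e => (ord0, inr (d e)) end.
pose same (i : 'I_q.+1) (e : D) : pformula L ('I_q.+1 * (Y + M)) :=
  pEq (tVar (i, inr (d e))) (tVar (ord0, inr (d e))).
pose samei (i : 'I_q.+1) : seq {classic pformula L ('I_q.+1 * (Y + M))} :=
  map (fun e : {classic D} => (same i e : {classic _})) sD.
pose sames : seq {classic pformula L ('I_q.+1 * (Y + M))} :=
  flatten [seq samei i | i <- enum 'I_q.+1].
exists (frename rphi (bigand F2)), q.+1,
  (pAnd (frename (fun m => (ord0, inr m)) delta)
    (pAnd (frename rpsi (bigand F1)) (bigand sames))); split.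
- move=> [x [y []]] /=; rewrite !sat_frename => -[dy [y1 /sat_bigand ysame]] y2.
  pose g : M -> M := y ord0 \o inr.
  pose v (z : V) : M := match z with inl w => y (inord w.1) (inl w.2) | inr w => x w end.
  apply: (delta_chi g dy); apply: (chiP g v).
    by congr (sat _ _): y1; apply/funext => -[[]|].
  move=> i; move: (y2 i); rewrite sat_frename; apply: Hs2 => -[[z|z]|e] //= es.
    by rewrite inord_val.
  rewrite /g /=; apply: (ysame (same i e)); apply/flattenP.
  exists (samei i).
    by apply/mapP; exists i; rewrite ?mem_enum.
  apply/mapP; exists e => //.
  by rewrite mem_pmap; apply/mapP; exists (inr e).
- move=> s Hs /=; rewrite !sat_frename; split; first exact: delta_id.
  split; last first.
    apply/sat_bigand => z /flattenP[_ /mapP[i _ ->] /mapP[e _ ->]].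
    by [].
  (* Psi speaks of infinite rows, so s is extended beyond q. *)
  have [s' s'incr s'E] := increasing_extension Hs.
  have /HS1 c1 := Psi_shift _ _ s'incr Psic.
  have : sat (bigand F1) (join (fun q0 : nat * Y => c (s' q0.1, q0.2)) d).
    by apply/sat_bigand => psi /F1S; exact: c1.
  apply: Hs1 => -[[n y]|e] //= ns.
  rewrite -s'E inordK // ltnS; apply: Hq; rewrite mem_cat; apply/orP; right.
  by rewrite mem_pmap; apply/mapP; exists (inl (n, y)).
- move=> x y /HS2 xy; rewrite sat_frename.
  have -> : join x (join y id) \o rphi = join (join x y) d by apply/funext => -[[]|].
  by apply/sat_bigand => th /F2S; exact: xy.
Qed.

Variable E : set M.

(** If tp(a/E) has no pattern indexed by K, one of the rows c al can be
    replaced by a row y with the same shift-invariant properties all of whose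
    entries share a solution x of Theta: otherwise the contradictions found
    for each row form such a pattern. *)
Lemma replace_row (X Y : countType) (a : X -> M) K D (d : D -> M)
    (Psi : K -> (nat * Y -> M) -> Prop) (Theta : K -> (X + Y -> M) -> Prop)
    (c : K -> nat * Y -> M) :
  small kappa [set: D] -> (forall al, tdef d (Psi al)) ->
  (forall al, tdef d (Theta al)) ->
  (forall al c' s, increasing s -> Psi al c' -> Psi al (fun q => c' (s q.1, q.2))) ->
  (forall al, Psi al (c al)) ->
  (forall f : K -> nat, exists x, tp_le E a x /\
    forall al, Theta al (join x (fun j => c al (f al, j)))) ->
  ~ has_pattern E a K (Y + M) ->
  exists al y x, Psi al y /\ forall i, Theta al (join x (fun j => y (i, j))).
Proof.
move=> Ds Psid Thd shift Psic paths nopat; apply: contrapT => no; apply: nopat.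
have ex al : exists phi : pformula L (X + (Y + M)),
    (exists p (psi : pformula L ('I_p * (Y + M))), row_inconsistent M phi psi /\
      row_satisfies psi (fun i => join (fun j => c al (i, j)) id)) /\
    forall x y, Theta al (join x y) -> sat phi (join x (join y id)).
  have [|phi [p [psi [H1 H2 H3]]]] :=
    row_contradiction Ds (Psid al) (Thd al) (shift al) (Psic al).
    by move=> y x Py xy; apply: no; exists al, y, x.
  by exists phi; split=> //; exists p, psi.
have [phi Hphi] := choice ex.
exists (fun al i => join (fun j => c al (i, j)) id), phi; split.
  by move=> al; exact: (Hphi al).1.
move=> f; have [x [ax Hx]] := paths f; exists x; split=> // al.
exact: (Hphi al).2.
Qed.

End Rule.

(** * A polarized pigeonhole principle *)

Lemma pigeonhole (C : finType) N (gamma : nat -> C) :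
  exists al, exists2 t, increasing t &
    forall i, i <= N -> t i < (#|C| * N).+1 /\ gamma (t i) = al.
Proof.
set m := (#|C| * N).+1.
have [al Hal] : exists al, N < count (fun i => gamma i == al) (iota 0 m).
  apply: contrapT => no.
  have : \sum_(al : C) count (fun i => gamma i == al) (iota 0 m) <= \sum_(al : C) N.
    by apply: leq_sum => al _; rewrite leqNgt; apply/negP => H; apply: no; exists al.
  have -> : \sum_(al : C) count (fun i => gamma i == al) (iota 0 m) = m.
    rewrite -[RHS](size_iota 0) -sum1_size (partition_big gamma predT) //=.
    by apply: eq_bigr => al _; rewrite sum1_count.
  by rewrite sum_nat_const ltnn.
pose ell := [seq i <- iota 0 m | gamma i == al].
have ell_sorted : sorted ltn ell.
  by apply: sorted_filter; [exact: ltn_trans|exact: iota_ltn_sorted].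
have ell_size : N < size ell by rewrite size_filter.
have [|t tincr tE] := @increasing_extension N (fun i => nth 0 ell i).
  move=> i j ij; apply: (sorted_ltn_nth ltn_trans) => //; rewrite inE.
    exact: leq_trans (ltn_ord i) ell_size.
  exact: leq_trans (ltn_ord j) ell_size.
exists al, t => // i iN; have iN' : i < N.+1 by [].
have -> : t i = nth 0 ell i by rewrite (tE (Ordinal iN')).
have : nth 0 ell i \in ell by apply: mem_nth; exact: leq_ltn_trans ell_size.
by rewrite mem_filter mem_iota add0n => /andP[/eqP -> /andP[_ ->]].
Qed.

(** The q coordinates are homogenized one at a time: the induction hypothesis
    is applied to a colouring by functions, which record the colours for the
    first m values of the last coordinate. *)
Lemma polarized q (C : finType) (col : (nat -> nat) -> C) N :
  exists al (s : nat -> nat -> nat), (forall r, increasing (s r)) /\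
    forall h : nat -> nat, (forall r, h r <= N) ->
      col (fun r => if r < q then s r (h r) else 0) = al.
Proof.
elim: q C col => [|q IH] C col.
  by exists (col (fun=> 0)), (fun=> id); split=> // r i j.
set m := (#|C| * N).+1.
pose ext (h : nat -> nat) i r := if r < q then h r else if r == q then i else 0.
pose col' (h : nat -> nat) := [ffun i : 'I_m => col (ext h i)].
have [gamma [s [sincr sP]]] := IH _ col'.
have [al [t tincr tP]] := pigeonhole N (fun i => gamma (inord i)).
exists al, (fun r => if r == q then t else s r); split.
  by move=> r; case: eqP.
move=> h hN; have [tm <-] := tP _ (hN q).
rewrite -(sP h hN) ffunE inordK //; congr col; apply/funext => r.
rewrite /ext ltnS leq_eqVlt; have [->|_] := eqVneq r q; first by rewrite ltnn.
by case: (r < q).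
Qed.

Lemma polarized_fin (R C : finType) (col : (R -> nat) -> C) N :
  exists al (s : R -> nat -> nat), (forall r, increasing (s r)) /\
    forall h : R -> nat, (forall r, h r <= N) -> col (fun r => s r (h r)) = al.
Proof.
have [al [s [sincr sP]]] :=
  polarized #|R| (fun h => col (fun r => h (enum_rank r))) N.
exists al, (fun r => s (enum_rank r)); split=> [r|h hN]; first exact: sincr.
pose h' i := if insub i is Some j then h (enum_val (j : 'I_#|R|)) else 0.
rewrite -(sP h') => [|i]; last by rewrite /h'; case: insub.
by congr col; apply/funext => r; rewrite ltn_ord /h' valK enum_rankK.
Qed.

(** * Submultiplicativity for two tuples *)

Section TwoTuples.
Variables (L : signature) (T : theory L) (kappa : Type) (M : structure L).
Hypotheses (nat_small : small kappa [set: nat]) (Msat : saturated kappa M).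
Hypothesis Mpec : pec T M.
Variables (E : set M) (E_small : small kappa E).
Variables (X0 X1 : finType) (a : X0 -> M) (b : X1 -> M) (k l : nat).

Let R : finType := ('I_k * 'I_l)%type.
Let V : countType := (R * nat * nat)%type.

Variable phi : R -> pformula L ((X0 + X1) + nat).
Variable psi : R -> {p & pformula L ('I_p * nat)}.

Definition entry (c : V -> M) r i : nat -> M := fun j => c (r, i, j).

Definition rows_ok (c : V -> M) := forall r, row_satisfies (projT2 (psi r)) (entry c r).

Definition on_path (act : pred R) (ix : R -> nat) c x x' :=
  tp_le E (join a b) (join x x') /\
  forall r, act r -> sat (phi r) (join (join x x') (entry c r (ix r))).

(** The same x serves all choices f of an entry in the rows bx, while the
    entries h of the other active rows are fixed. *)
Definition common (act bx : pred R) (h : R -> nat) c (x : X0 -> M) :=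
  forall f : R -> nat, exists x', on_path act (fun r => if bx r then f r else h r) c x x'.

Definition uniform act bx h c := exists x, common act bx h c x.

Lemma common_sub (act bx act' bx' : pred R) (h h' : R -> nat) (c c' : V -> M) x :
  (forall f', exists f, forall r, act' r -> act r /\
    entry c' r (if bx' r then f' r else h' r) = entry c r (if bx r then f r else h r)) ->
  common act bx h c x -> common act' bx' h' c' x.
Proof.
move=> sub Hc f'; have [f Hf] := sub f'; have [x' [tpx Hx']] := Hc f.
by exists x'; split=> // r /Hf[/Hx' + ->].
Qed.

Definition parE : {e | E e} -> M := sval.

Let Es_small : small kappa [set: {e | E e}] := small_sig E_small.

Lemma tdef_tp_le W (s : X0 + X1 -> W) :
  tdef parE (fun w : W -> M => tp_le E (join a b) (w \o s)).
Proof.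
apply: tdef_all => p; apply: tdef_all => _.
exact: (tdef_comp s (tdef_par parE p)).
Qed.

Lemma tdef_common act bx h :
  tdef parE (fun w : V + X0 -> M => common act bx h (w \o inl) (w \o inr)).
Proof.
apply: tdef_all => f.
pose P (u : (V + X0) + X1 -> M) := on_path act (fun r => if bx r then f r else h r)
  (u \o inl \o inl) (u \o inl \o inr) (u \o inr).
suff Pd : tdef parE P.
  apply: tdef_iff (tdef_ex nat_small Msat Es_small
    (small_countType nat_small X1) Pd) => w.
  by split=> -[x' Hx']; exists x'.
apply: tdef_and.
  pose s (z : X0 + X1) : (V + X0) + X1 :=
    match z with inl x => inl (inr x) | inr x => inr x end.
  apply: tdef_iff (tdef_tp_le s) => u.
  suff -> : u \o s = join (u \o inl \o inr) (u \o inr) by [].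
  by apply/funext => -[].
apply: tdef_all => r; apply: tdef_all => _.
pose s (z : (X0 + X1) + nat) : (V + X0) + X1 := match z with
  | inl (inl x) => inl (inr x) | inl (inr x) => inr x
  | inr j => inl (inl (r, if bx r then f r else h r, j)) end.
apply: tdef_iff (tdef_comp s (tdef_sat parE (phi r))) => u.
set w := join _ _; suff -> : u \o s = w by [].
by apply/funext => -[[]|].
Qed.

Lemma tdef_uniform act bx h : tdef parE (fun c : V -> M => uniform act bx h c).
Proof.
exact: tdef_iff (tdef_ex nat_small Msat Es_small
  (small_countType nat_small X0) (tdef_common act bx h)).
Qed.

Lemma tdef_rows_ok : tdef parE rows_ok.
Proof.
apply: tdef_all => r; apply: tdef_all => s; apply: tdef_all => _.
exact: (tdef_comp (fun q => (r, s q.1, q.2)) (tdef_sat parE (projT2 (psi r)))).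
Qed.

Definition reindex (s : R -> nat -> nat) (c : V -> M) : V -> M :=
  fun z => c (z.1.1, s z.1.1 z.1.2, z.2).

Lemma rows_ok_reindex s c :
  (forall r, increasing (s r)) -> rows_ok c -> rows_ok (reindex s c).
Proof.
move=> sincr cok r t tincr; apply: (cok r (s r \o t)) => i j ij /=.
exact/sincr/tincr.
Qed.

Lemma uniform_reindex act bx h c s :
  uniform act bx (fun r => s r (h r)) c -> uniform act bx h (reindex s c).
Proof.
move=> [x Hx]; exists x; apply: common_sub Hx => f'.
by exists (fun r => s r (f' r)) => r ar; split=> //; rewrite /entry /reindex /=; case: ifP.
Qed.

(** In each column before beta one row has been selected, that of index g,
    and one x serves all its entries; in the columns from beta on, one entry
    is fixed in every row. *)
Definition act beta (g : 'I_l -> 'I_k) : pred R :=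
  fun r => (beta <= r.2) || (r.1 == g r.2).
Definition box beta (g : 'I_l -> 'I_k) : pred R :=
  fun r => (r.2 < beta) && (r.1 == g r.2).

Definition stage beta g c :=
  rows_ok c /\ forall h, uniform (act beta g) (box beta g) h c.

Section Step.
Variables (beta : 'I_l) (g : 'I_l -> 'I_k).

Definition select (al : 'I_k) : 'I_l -> 'I_k := fun b => if b == beta then al else g b.

Definition selected al h c := uniform (act beta.+1 (select al)) (box beta.+1 (select al)) h c.

Definition progress (H : seq {classic (R -> nat)}) c :=
  stage beta g c /\ forall h, h \in H -> exists al, selected al h c.

Lemma tdef_progress H : tdef parE (progress H).
Proof.
apply: tdef_and; first apply: tdef_and.
- exact: tdef_rows_ok.
- by apply: tdef_all => h; exact: tdef_uniform.
- apply: tdef_all => h; apply: tdef_all => _.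
  by apply: tdef_ex_fin => al; exact: tdef_uniform.
Qed.

Lemma select_off al r : r.2 != beta ->
  act beta.+1 (select al) r = act beta g r /\ box beta.+1 (select al) r = box beta g r.
Proof.
move=> rb; have rb' : (r.2 == beta :> nat) = false by exact: negbTE.
rewrite /act /box /select (negbTE rb) ltnS.
by rewrite (leq_eqVlt r.2) (leq_eqVlt beta) (eq_sym (beta : nat)) rb'.
Qed.

Lemma select_on al al' : act beta.+1 (select al) (al', beta) = (al' == al) /\
  box beta.+1 (select al) (al', beta) = (al' == al).
Proof. by rewrite /act /box /select /= eqxx ltnn leqnn. Qed.

(** Passing to a subsequence of a row of the column beta preserves the progress
    made: no h fixes an entry of that column in the conditions selected al h. *)
Lemma progress_shift H c al s : increasing s -> progress H c ->
  progress H (reindex (fun r => if r == (al, beta) then s else id) c).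
Proof.
move=> sincr [[cok cH] cp]; split; first split.
- by apply: rows_ok_reindex cok => r; case: eqP => [_|_ i j]; [exact: sincr|].
- by move=> h; exact: uniform_reindex.
- move=> h /cp[al' [x Hx]]; exists al'; apply: uniform_reindex; exists x.
  apply: common_sub Hx => f; exists f => r ar; split=> //.
  case: ifP => // nbox; case: eqP => // rE; move: ar nbox; rewrite rE.
  by have [-> ->] := select_on al' al => ->.
Qed.

Definition update (c : V -> M) r (y : nat * nat -> M) : V -> M :=
  fun z => if z.1.1 == r then y (z.1.2, z.2) else c z.

Hypothesis nopat : ~ has_pattern E a 'I_k (nat + M).

(** The choices h in H are treated one by one.  For h0, replace_row is applied
    to the rows of the column beta, with Psi all the progress made so far and
    with all other rows as parameters; a path f through the column is solved
    by the x that stage beta provides for h0 modified by f. *)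
Lemma progress_all c0 H : stage beta g c0 -> exists c, progress H c.
Proof.
move=> st0; elim: H => [|h0 H [c cH]]; first by exists c0; split.
pose u z := match z with inl y => inl y | inr x => inr x end : nat * nat + V.
pose su al (z : V) : nat * nat + V :=
  if z.1.1 == (al, beta) then inl (z.1.2, z.2) else inr z.
have suE al y : join y c \o su al = update c (al, beta) y.
  by apply/funext => z; rewrite /su /update /=; case: ifP.
pose cst al (y : nat -> M) := update c (al, beta) (fun q => y q.2).
pose st al (z : V + X0) : (X0 + nat) + V := match z with
  | inl z => if z.1.1 == (al, beta) then inl (inr z.2) else inr z
  | inr x => inl (inl x) end.
pose Psi al y := progress H (update c (al, beta) y).
pose Theta al (w : X0 + nat -> M) :=
  common (act beta.+1 (select al)) (box beta.+1 (select al)) h0 (cst al (w \o inr)) (w \o inl).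
have Psid al : tdef (join parE c) (Psi al).
  by apply: tdef_iff (tdef_subst c (su al) (tdef_progress H)) => y; rewrite suE.
have Thd al : tdef (join parE c) (Theta al).
  apply: tdef_iff (tdef_subst c (st al) (tdef_common (act beta.+1 (select al))
    (box beta.+1 (select al)) h0)) => w.
  suff -> : (join w c \o st al) \o inl = cst al (w \o inr) by [].
  by apply/funext => z; rewrite /cst /update /=; case: ifP.
have shift al y s : increasing s -> Psi al y -> Psi al (fun q => y (s q.1, q.2)).
  move=> sincr /(progress_shift al sincr); congr (progress H _).
  by apply/funext => -[[r i] j]; rewrite /reindex /update /=; case: (r == _).
have Psic al : Psi al (fun q => c ((al, beta), q.1, q.2)).
  congr (progress H _): cH; apply/funext => -[[r i] j].
  by rewrite /update /=; case: eqP => [->|].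
have paths (f : 'I_k -> nat) : exists x, tp_le E a x /\
    forall al, Theta al (join x (fun j => c ((al, beta), f al, j))).
  pose h r := if r.2 == beta then f r.1 else h0 r.
  have [x Hx] := cH.1.2 h; exists x; split=> [|al].
    by have [x' [/(tp_le_comp (e := inl))]] := Hx h.
  apply: common_sub Hx => f'; exists f' => -[al' b'].
  have [/= ->|nb] := eqVneq b' beta.
    have [-> ->] := select_on al al' => /eqP ->; split; first by rewrite /act /= leqnn.
    by rewrite /box /= ltnn /h /= eqxx /entry /cst /update /= !eqxx.
  have [-> ->] := @select_off al (al', b') nb => ar; split=> //.
  rewrite /h /= (negbTE nb) /entry /cst /update /=.
  by rewrite xpair_eqE (negbTE nb) andbF.
have [al [y [x [Py Hx]]]] := replace_row nat_small Msat Mpec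
  (small_sum nat_small V Es_small) Psid Thd shift Psic paths nopat.
exists (update c (al, beta) y); split; first exact: Py.1.
move=> h; rewrite inE => /orP[/eqP ->|/Py.2//].
exists al, x => f; have [x' [tpx Hx']] := Hx (f (al, beta)) f.
exists x'; split=> // -[al' b'] ar; move: (Hx' _ ar); congr (sat _ (join _ _)).
rewrite /entry /cst /update /=; case: eqP => // -[Ea Eb]; move: ar; rewrite Ea Eb.
by have [-> ->] := select_on al al => ->.
Qed.

(** Compactness is used twice: to reach all h at once, each with its own row
    col h, then to pass from boxes of entries where col is constant, of sizes
    N, to a whole array.  The row al of such a box may depend on N; as it
    takes finitely many values and a box contains smaller ones, one al works
    for all N. *)
Lemma next_stage c0 : stage beta g c0 -> exists al c, stage beta.+1 (select al) c.
Proof.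
move=> st0.
have [||c1 Hc1] := tdef_fip (d := parE) (V := V) (J := R -> nat)
    (P := fun h c => rows_ok c /\ exists al, selected al h c) Msat Es_small
    (small_countType nat_small V).
- move=> h; apply: tdef_and; first exact: tdef_rows_ok.
  by apply: tdef_ex_fin => al; exact: tdef_uniform.
- move=> H; have [c [[cok _] cH]] := progress_all H st0.
  by exists c => h /cH.
have c1ok : rows_ok c1 := (Hc1 (fun=> 0)).1.
have [col Hcol] := choice (fun h => (Hc1 h).2).
have bounded N : exists al c, rows_ok c /\
    forall h : R -> nat, (forall r, h r <= N) -> selected al h c.
  have [al [s [sincr sP]]] := polarized_fin col N.
  exists al, (reindex s c1); split; first exact: rows_ok_reindex.
  by move=> h hN; apply: uniform_reindex; rewrite -(sP h hN); exact: Hcol.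
have [al Hal] : exists al, forall N, exists c, rows_ok c /\
    forall h : R -> nat, (forall r, h r <= N) -> selected al h c.
  apply: contrapT => no.
  have /choice[N HN] (al : 'I_k) : exists N, ~ exists c, rows_ok c /\
      forall h : R -> nat, (forall r, h r <= N) -> selected al h c.
    by apply: contrapT => noN; apply: no; exists al => N;
      apply: contrapT => nc; apply: noN; exists N.
  have [al [c [cok cN]]] := bounded (\max_al N al).
  apply: (HN al); exists c; split=> // h hN; apply: cN => r.
  exact: leq_trans (hN r) (leq_bigmax al).
have [||c Hc] := tdef_fip (d := parE) (V := V) (J := R -> nat)
    (P := fun h c => rows_ok c /\ selected al h c) Msat Es_small
    (small_countType nat_small V).
- move=> h; apply: tdef_and; first exact: tdef_rows_ok.
  exact: tdef_uniform.
- move=> H; have [N HN] : exists N, forall h, h \in H -> forall r, h r <= N.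
    elim: H => [|h H [N HN]]; first by exists 0.
    exists (maxn (\max_r h r) N) => h'; rewrite inE => /orP[/eqP -> r|/HN h'N r].
      exact: leq_trans (leq_bigmax r) (leq_maxl _ _).
    exact: leq_trans (h'N r) (leq_maxr _ _).
  have [c [cok cN]] := Hal N.
  by exists c => h /HN hN; split=> //; exact: cN.
by exists al, c; split=> [|h]; [exact: (Hc (fun=> 0)).1|exact: (Hc h).2].
Qed.

End Step.

Lemma all_stages beta c0 (g0 : 'I_l -> 'I_k) : ~ has_pattern E a 'I_k (nat + M) ->
  rows_ok c0 -> (forall h, uniform predT pred0 h c0) -> beta <= l ->
  exists g c, stage beta g c.
Proof.
move=> nopat c0ok c0u; elim: beta => [|beta IH] bl.
  by exists g0, c0; split=> // h; have [x Hx] := c0u h; exists x.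
have [g [c Hc]] := IH (ltnW bl).
have [al [c' Hc']] := @next_stage (Ordinal bl) g nopat c Hc.
by exists (select (Ordinal bl) g al), c'.
Qed.

End TwoTuples.

Section Submultiplicativity.
Variables (L : signature) (T : theory L) (kappa : Type) (M : structure L).
Hypotheses (nat_small : small kappa [set: nat]) (Msat : saturated kappa M).
Hypothesis Mpec : pec T M.
Variables (E : set M) (E_small : small kappa E).

(** After the last stage no entry is fixed any more, and x can be added to
    the entries of the selected rows. *)
Lemma two_tuples (X0 X1 : finType) (a : X0 -> M) (b : X1 -> M) k l :
  has_pattern E (join a b) ('I_k * 'I_l)%type nat ->
  ~ has_pattern E a 'I_k (nat + M) -> has_pattern E b 'I_l (X0 + nat).
Proof.
move=> [c [phi [incons paths]]] nopat.
have /choice[psi Hpsi] (r : 'I_k * 'I_l) : exists t : {p & pformula L ('I_p * nat)},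
    row_inconsistent M (phi r) (projT2 t) /\ row_satisfies (projT2 t) (c r).
  by have [p [psi H]] := incons r; exists (existT _ p psi).
have k_gt0 : 0 < k.
  rewrite lt0n; apply/negP => /eqP k0; apply: nopat; rewrite k0.
  have [m0] := carrier_inhabited M.
  exists (fun _ _ _ => m0), (fun=> pTop); split; first by case.
  by move=> f; exists a; split=> // -[].
pose c0 (z : 'I_k * 'I_l * nat * nat) := c z.1.1 z.1.2 z.2.
have c0ok : rows_ok psi c0 by move=> r; exact: (Hpsi r).2.
have c0u h : uniform E a b phi predT pred0 h c0.
  have [x0 [tpx Hx]] := paths h; exists (x0 \o inl) => f; exists (x0 \o inr).
  have E0 : join (x0 \o inl) (x0 \o inr) = x0 by apply/funext => -[].
  by split; rewrite E0 // => r _; exact: Hx.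
have [g [c1 [c1ok c1u]]] := all_stages nat_small Msat Mpec E_small
  (fun=> Ordinal k_gt0) nopat c0ok c0u (leqnn l).
have [x Hx] := c1u (fun=> 0).
pose row1 (be : 'I_l) i : nat -> M := fun j => c1 ((g be, be), i, j).
pose t (z : (X0 + X1) + nat) : X1 + (X0 + nat) := match z with
  | inl (inl z) => inr (inl z) | inl (inr z) => inl z | inr j => inr (inr j) end.
have tE x' (z : X0 -> M) y : join x' (join z y) \o t = join (join z x') y.
  by apply/funext => -[[]|].
exists (fun be i => join x (row1 be i)), (fun be => frename t (phi (g be, be))); split.
  move=> be; move: (Hpsi (g be, be)) (c1ok (g be, be)).
  case: (psi (g be, be)) => p q /= [qincons _] qok.
  (* The entries now carry a copy of x each; these copies must agree. *)
  pose same z : pformula L ('I_p * (X0 + nat)) :=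
    pEq (tVar (z.1.1, inl z.2)) (tVar (z.1.2, inl z.2)).
  pose sames : seq {classic pformula L ('I_p * (X0 + nat))} :=
    [seq (same z : {classic _}) | z <- enum {: 'I_p * 'I_p * X0}].
  exists p, (pAnd (frename (fun q => (q.1, inr q.2)) q) (bigand sames)); split.
    move=> [x' [y [/= [saty /sat_bigand ysame] satx]]]; apply: qincons.
    have [z zE] : exists z, forall i, y i \o inl = z.
      have [[i0]|no] := pselect (inhabited 'I_p); last first.
        have [m0] := carrier_inhabited M.
        by exists (fun=> m0) => i; case: no.
      exists (y i0 \o inl) => i; apply/funext => j.
      apply: (ysame (same (i, i0, j))).
      by apply/mapP; exists (i, i0, j); rewrite ?mem_enum.
    exists (join z x'), (fun i => y i \o inr); split.
      by move: saty; rewrite sat_frename.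
    move=> i; have := satx i; rewrite sat_frename -(zE i) -tE.
    by congr (sat _ (join _ _ \o _)); apply/funext => -[].
  move=> s Hs; rewrite /= sat_frename; split; first exact: qok.
  by apply/sat_bigand => z /mapP[w _ ->].
move=> f; have [x' [tpx Hx']] := Hx (fun r => f r.2).
exists x'; split=> [|be]; first exact: (tp_le_comp (e := inr) tpx).
rewrite sat_frename tE.
have := Hx' (g be, be); rewrite /act /box /= eqxx ltn_ord orbT /=; exact.
Qed.

(** * Changing the tuple, and finitely many tuples *)

(** A solution x of a path realizes tp(a \o e/E).  It is extended to x' realizing
    tp(a/E), by compactness: the existential closure over the other variables
    of a formula of tp(a/E) belongs to tp(a \o e/E). *)
Lemma has_pattern_extend (X : finType) X' (e : X -> X') (a : X' -> M) K Y :
  small kappa [set: X'] -> has_pattern E (a \o e) K Y -> has_pattern E a K Y.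
Proof.
move=> Xs [c [phi [incons paths]]].
pose lmap (z : X + Y) : X' + Y := match z with inl x => inl (e x) | inr y => inr y end.
have lmapE (x : X' -> M) (y : Y -> M) : join x y \o lmap = join (x \o e) y.
  by apply/funext => -[].
exists c, (fun al => frename lmap (phi al)); split.
  move=> al; have [p [psi [H1 H2]]] := incons al; exists p, psi; split=> //.
  move=> [x [y [saty satx]]]; apply: H1; exists (x \o e), y; split=> // i.
  by have := satx i; rewrite sat_frename lmapE.
move=> f; have [x [ax Hx]] := paths f.
suff [x' ax' x'e] : exists2 x', tp_le E a x' & x' \o e = x.
  exists x'; split=> // al; rewrite sat_frename lmapE x'e; exact: Hx.
pose ES := {z | E z}.
pose J := option {p : pformula L (X' + ES) | sat p (join a sval)}.
pose d : ES + X -> M := join sval x.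
pose P (j : J) (v : X' -> M) := match j with
  | Some p => sat (sval p) (join v sval) | None => forall i, v (e i) = x i end.
have [||v Hv] := tdef_fip (d := d) (V := X') (P := P) Msat
  (small_sum nat_small X (small_sig E_small)) Xs.
- move=> [p|].
    have := tdef_par d (frename (rmap inl) (sval p)).
    by apply: tdef_iff => v; rewrite sat_frename join_rmap.
  apply: tdef_all => i.
  have := tdef_par d (pEq (tVar (inl (e i))) (tVar (inr (inr i)))).
  exact: tdef_iff.
- move=> s.
  pose F : seq {classic pformula L (X' + ES)} :=
    pmap (fun j : {classic J} => omap (fun p => sval p : {classic _}) (j : J)) s.
  pose t1 (z : X' + ES) : (X + ES) + X' :=
    match z with inl z => inr z | inr z => inl (inr z) end.
  pose eqs : seq {classic pformula L ((X + ES) + X')} :=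
    [seq (pEq (tVar (inr (e i))) (tVar (inl (inl i))) : {classic _}) | i <- enum X].
  have [chi Hchi] := ex_closure (pAnd (frename t1 (bigand F)) (bigand eqs)).
  have t1E (y : X -> M) (v : X' -> M) : join (join y sval) v \o t1 = join v sval.
    by apply/funext => -[].
  have [v] : exists v : X' -> M, sat (pAnd (frename t1 (bigand F)) (bigand eqs))
      (join (join x sval) v).
    apply/Hchi/ax/Hchi; exists a => /=; rewrite sat_frename t1E; split.
      apply/sat_bigand => p; rewrite mem_pmap => /mapP[[[z Sz]|//] _ [->]].
      exact: Sz.
    by apply/sat_bigand => p /mapP[i _ ->].
  rewrite /= sat_frename t1E => -[/sat_bigand v1 /sat_bigand v2].
  exists v => -[p|] js /=.
    by apply: v1; rewrite mem_pmap; apply/mapP; exists (Some p).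
  move=> i; apply: (v2 (pEq (tVar (inr (e i))) (tVar (inl (inl i))))).
  by apply/mapP; exists i; rewrite ?mem_enum.
- exists v; last by apply/funext => i; exact: (Hv None).
  by move=> p satp; exact: (Hv (Some (exist _ p satp))).
Qed.

Lemma inp_reindex X (pi : set (Mformula M X)) K K' (j : K' -> K) : injective j ->
  inhabited (inp_pattern T pi K) -> inhabited (inp_pattern T pi K').
Proof.
move=> jinj [[len arr form incons cons]]; apply: inhabits.
apply: (@InpPattern L T M X pi K' (fun al => len (j al))
  (fun al => arr (j al)) (fun al => form (j al))); first by move=> al; exact: incons.
move=> f.
pose f' al := if pselect (exists al', j al' = al) is left h then f (projT1 (cid h)) else 0.
have f'j al : f' (j al) = f al.
  rewrite /f'; case: pselect => [h|[]]; last by exists al.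
  by case: cid => al' /= /jinj ->.
have [N [h [x [NT hh Hx]]]] := cons f'; exists N, h, x; split=> // mf [mfpi|[al _ <-]].
  by apply: Hx; left.
rewrite -f'j; apply: (Hx (MFormula (form (j al)) (arr (j al) (f' (j al))))).
by right; exists (j al).
Qed.

(** The formulas of a pattern of finite depth mention finitely many of the
    variables x. *)
Lemma inp_restrict X (a : X -> M) (K : finType) : inhabited (inp_pattern T (tp a E) K) ->
  exists n (e : 'I_n -> X), inhabited (inp_pattern T (tp (a \o e) E) K).
Proof.
move=> [[len arr form incons cons]].
have /choice[sX HsX] (al : K) : exists sX : seq {classic X},
    forall (N : structure L) (x x' : X -> N) y, (forall z, z \in sX -> x z = x' z) ->
    sat (form al) (join x y) -> sat (form al) (join x' y).
  have [s Hs] := support_exists (form al).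
  exists (pmap (fun z : {classic X + 'I_(len al)} =>
    if (z : X + 'I_(len al)) is inl x then Some (x : {classic X}) else None) s).
  move=> N x x' y xx'; apply: Hs => -[z|//] zs /=; apply: xx'.
  by rewrite mem_pmap; apply/mapP; exists (inl z).
have [n [r [e re]]] := finite_names (flatten [seq sX al | al <- enum K]).
exists n, e; apply: inhabits.
pose lmap Y (f : X -> 'I_n) (z : X + Y) : 'I_n + Y :=
  match z with inl x => inl (f x) | inr y => inr y end.
have lmapE (N : structure L) Y (x : 'I_n -> N) (y : Y -> N) :
    join x y \o lmap Y r = join (x \o r) y by apply/funext => -[].
apply: (@InpPattern L T M _ (tp (a \o e) E) K len arr
  (fun al => frename (lmap _ r) (form al))).
  move=> al; have [p [psi [H1 H2]]] := incons al; exists p, psi; split=> //.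
  move=> [x [y [saty satx]]]; apply: H1; exists (x \o r), y; split=> // i.
  by have := satx i; rewrite sat_frename lmapE.
move=> f; have [N [h [x [NT hh Hx]]]] := cons f.
exists N, h, (x \o e); split=> // mf [[mE mfa]|[al _ <-]] /=.
  pose lmap' (z : 'I_n + 'I_(mlen mf)) : X + 'I_(mlen mf) :=
    match z with inl i => inl (e i) | inr y => inr y end.
  have lmap'E (N' : structure L) (w : X -> N') y : join w y \o lmap' = join (w \o e) y.
    by apply/funext => -[].
  have := Hx (MFormula (frename lmap' (mform mf)) (mpar mf)).
  rewrite /= sat_frename lmap'E; apply; left; split=> //.
  by rewrite /msat /= sat_frename lmap'E.
rewrite sat_frename lmapE.
have : sat (form al) (join x (h \o arr al (f al))).
  by apply: (Hx (MFormula (form al) (arr al (f al)))); right; exists al.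
apply: HsX => z zs /=.
have zX : z \in flatten [seq sX al | al <- enum K].
  by apply/flattenP; exists (sX al) => //; apply/mapP; exists al; rewrite ?mem_enum.
by rewrite (re _ zX).
Qed.

(** The tuples are the parts of v where col is constant.  The part of colour n
    is split off, and two_tuples applies to the parts of smaller colour,
    taken together, and to it. *)
Lemma many_tuples n (X : finType) (v : X -> M) (col : X -> nat) (k : nat -> nat) :
  (forall j, col j < n) ->
  inhabited (inp_pattern T (tp v E) 'I_(\prod_(i < n) k i)) ->
  exists i, i < n /\ exists (Y : finType) (e : Y -> X), (forall y, col (e y) = i) /\
    inhabited (inp_pattern T (tp (v \o e) E) 'I_(k i)).
Proof.
elim: n X v col => [|n IH] X v col coln.
  move=> /(has_pattern_of_inp nat_small Msat Mpec E_small (small_countType nat_small X)).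
  move=> [c [phi [incons paths]]].
  have al : 'I_(\prod_(i < 0) k i) by rewrite big_ord0; exact: ord0.
  have [p [psi [H1 H2]]] := incons al; case: H1.
  have [x _] := paths (fun=> 0); exists x, (fun i => c al i); split.
    exact: (H2 val).
  move=> i; have [x' [_ /(_ al)]] := paths (fun=> i : nat).
  by congr (sat _ (join _ _)); apply/funext => j; have := coln j.
move=> Hpat.
pose X0 := {j : X | col j < n}; pose X1 := {j : X | col j == n}.
have /choice[e He] (j : X) : exists z : X0 + X1,
    join (v \o val) (v \o val) z = v j.
  have := coln j; rewrite ltnS leq_eqVlt => /orP[jn|jn].
    by exists (inr (exist _ j jn)).
  by exists (inl (exist _ j jn)).
have cardK : #|{: 'I_(\prod_(i < n) k i) * 'I_(k n)}| = \prod_(i < n.+1) k i.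
  by rewrite card_prod !card_ord big_ord_recr.
have Kinj : injective (fun q : 'I_(\prod_(i < n) k i) * 'I_(k n) =>
    cast_ord cardK (enum_rank q)).
  by move=> q q' /cast_ord_inj/enum_rank_inj.
have {Hpat} := inp_reindex Kinj Hpat.
have -> : v = join (v \o val) (v \o val) \o e by apply/funext => j; rewrite /= He.
move=> /(has_pattern_of_inp nat_small Msat Mpec E_small (small_countType nat_small X)).
move=> /(has_pattern_extend (small_countType nat_small (X0 + X1)%type)) Hpat.
have [pat0|nopat0] := pselect (has_pattern E (v \o val : X0 -> M)
    'I_(\prod_(i < n) k i) (nat + M)).
  have [||i [ilt [Y [e' [e'i Hi]]]]] := IH X0 (v \o val) (col \o val).
  - by move=> [j jn].
  - by have := inp_of_has_pattern Mpec pat0.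
  - exists i; split; first exact: ltnW.
    exists Y, (val \o e'); split=> //.
    move: Hi; congr inhabited; congr (inp_pattern T (tp _ E) _).
    by apply/funext => y /=; rewrite He.
have pat1 := two_tuples Hpat nopat0.
exists n; split=> //; exists X1, val; split.
  by move=> [j jn]; exact/eqP.
have := inp_of_has_pattern Mpec pat1; congr inhabited; congr (inp_pattern T (tp _ E) _).
by apply/funext => y /=; rewrite He.
Qed.

(** * Burden below a finite bound *)

(** Depths of patterns are downward closed (inp_reindex).  So if k is not a depth,
    some m < k is the largest one, and m is the burden. *)
Lemma burden_ltP X (a : X -> M) k :
  burden_lt T (tp a E) k <-> ~ inhabited (inp_pattern T (tp a E) 'I_k).
Proof.
have leII m n : ([set: 'I_m] #<= [set: 'I_n]) = (m <= n).
  by rewrite -(card_le_eql card_II) -(card_le_eqr card_II) card_le_II.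
split=> [[C [bC _] [_ nkC]] /bC //|nopat].
pose Q m := inhabited (inp_pattern T (tp a E) 'I_m).
have Q0 : Q 0.
  apply: inhabits; apply: (@InpPattern L T M _ (tp a E) 'I_0 (fun=> 0)
    (fun _ _ i => match notF (ltn_ord i) with end) (fun=> pTop)); first by case.
  move=> f; exists M, id, a; split=> //; first exact: Mpec.1.
  by move=> mf [[_]|[[]]].
have [m [mk Qm nQm]] : exists m, [/\ m < k, Q m & ~ Q m.+1].
  elim: k nopat => [//|k IH] nk; have [Qk|nQk] := pselect (Q k); first by exists k.
  by have [m [mk Qm nQm]] := IH nQk; exists m; split=> //; exact: ltnW.
have bound : bounds_depths T (tp a E) 'I_m.
  move=> K HK; apply: contrapT => nKm; apply: nQm.
  suff /card_le_typeP[j jinj] : [set: 'I_m.+1] #<= [set: K] by exact: inp_reindex jinj HK.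
  have [/finite_setP[q Kq]|] := pselect (finite_set [set: K]); last first.
    move=> /infiniteP; apply: card_le_trans; exact: countableP.
  rewrite (card_le_eqr Kq) -(card_le_eql card_II) card_le_II ltnNge; apply/negP => qm.
  apply: nKm; rewrite (card_le_eql Kq) -(card_le_eqr card_II).
  by rewrite card_le_II.
exists 'I_m; last by split; [rewrite leII ltnW|rewrite leII leqNgt mk].
by split=> // C' bC'; exact: bC'.
Qed.

End Submultiplicativity.

Theorem corollary4p18 (L : signature) (T : theory L)
  (T_JCP : joint_continuation T)
  (kappa : Type) (M : structure L) (M_monster : monster T kappa M)
  (E : set M) (E_small : small kappa E)
  (n : nat) (X : 'I_n -> Type) (X_small : forall i, small kappa [set: X i]%classic)
  (a : forall i : 'I_n, X i -> M) (k : 'I_n -> nat) :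
  (forall i, burden_lt T (tp (a i) E) (k i)) ->
  burden_lt T (tp (concat a) E) (\prod_(i < n) k i).
Proof.
move=> ak; have [nat_small _ _ Mpec Msat _] := M_monster.
apply/(burden_ltP Mpec) => Hpat.
have [N [e {}Hpat]] := inp_restrict Hpat.
(* The finite tuple is cut according to the tuple a i each variable comes from. *)
pose k' (i : nat) := if insub i is Some j then k j else 0.
have prodE : \prod_(i < n) k i = \prod_(i < n) k' i.
  by apply: eq_bigr => i _; rewrite /k' valK.
rewrite prodE in Hpat.
have [|i [i_n [Y [e' [e'i Hi]]]]] := many_tuples nat_small Msat Mpec E_small
  (col := fun j => projT1 (e j) : nat) _ Hpat; first by move=> j.
pose io := Ordinal i_n.
have /choice[e'' He''] (y : Y) : exists z : X io, e (e' y) = existT _ io z.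
  have : projT1 (e (e' y)) = io by apply: val_inj; exact: e'i.
  by case: (e (e' y)) => [j z] /= jE; move: z; rewrite jE => z; exists z.
have vE : (concat a \o e) \o e' = @a io \o e''.
  by apply/funext => y; rewrite /= He''.
have /(burden_ltP Mpec) nk := ak io; apply: nk.
apply: (inp_of_has_pattern Mpec).
apply: (has_pattern_extend nat_small Msat E_small (X_small io) (e := e'')).
have kE : k io = k' i by rewrite /k' insubT.
rewrite -vE kE.
exact: (has_pattern_of_inp nat_small Msat Mpec E_small (small_countType nat_small Y) Hi).
Qed.
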